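(* Let $\vec\alpha=(\alpha_i)_{i\ge1}$, $\vec\beta=(\beta_i)_{i\ge1}$ be sequences of non-negative reals and $\gamma\ge0$ a real with $\gamma+\sum_i\alpha_i+\sum_i\beta_i=1$. Let $n\ge1$ and let $\pi\in S_n$ be a random permutation distributed as a $(\vec\alpha,\vec\beta,\gamma)$ shuffle. Let $\lambda$ be a partition of $n$ and let $Q$ be any standard Young tableau of shape $\lambda$. Then the probability that the Robinson-Schensted-Knuth recording tableau of $\pi$ equals $Q$ is $S_\lambda(\vec\alpha,\vec\beta,\gamma)$.
   Context: **$(\vec\alpha,\vec\beta,\gamma)$ shuffle.** This is the following probability measure on $S_n$. Choose a word $w_1\cdots w_n$ of integers with independent letters: each letter equals $i>0$ with probability $\alpha_i$, equals $-i<0$ with probability $\beta_i$ ($i\geq 1$), and equals $0$ with probability $\gamma$. Process the distinct letters occurring in the word in increasing order (usual order on $\mathbb Z$), assigning to the positions of each letter the next unused block of consecutive integers from $1,2,\dots,n$ (the block having as many elements as the letter has occurrences). Within the block of a negative letter, the integers are written under its occurrences in decreasing order from left to right. Within the block of a positive letter, they are written in increasing order from left to right. Within the block of the letter $0$, they are written in a uniformly random order (independent of everything else). Then $\pi(k)$ is the integer written under $w_k$. **Extended Schur functions.** The extended complete symmetric functions $\tilde h_k(\vec\alpha,\vec\beta,\gamma)$ are defined by $$\sum_{k\ge0}\tilde h_k(\vec\alpha,\vec\beta,\gamma)z^k=e^{\gamma z}\prod_{i\ge1}\frac{1+\beta_iz}{1-\alpha_iz},$$ with $\tilde h_k=0$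 for $k<0$. For a partition $\lambda=(\lambda_1,\dots,\lambda_m)$, $S_\lambda(\vec\alpha,\vec\beta,\gamma)=\det(\tilde h_{\lambda_i-i+j})_{i,j=1}^m$. The RSK correspondence is applied by row inserting $\pi(1),\pi(2),\dots,\pi(n)$; the recording tableau records the order in which boxes are added. *)

(* Defs.v *)
From HB Require Import structures.
From mathcomp Require Import all_boot all_order all_algebra all_fingroup.
From mathcomp Require Import all_classical all_reals all_analysis.

Set Implicit Arguments.
Unset Strict Implicit.
Unset Printing Implicit Defensive.

Import Order.TTheory GRing.Theory Num.Theory.
Import numFieldNormedType.Exports.

Local Open Scope classical_set_scope.
Local Open Scope ring_scope.

(* Conventions: the parameter sequences are indexed from 0, so [a i] and [b i]
   stand for alpha_(i+1) and beta_(i+1); positions and values of a permutation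
   are elements of 'I_n, i.e. 0, ..., n-1 instead of 1, ..., n. *)

Section Shuffle.
Variable R : realType.
Implicit Types (a b : nat -> R) (g : R).

Definition shuffle_params a b g : Prop :=
  [/\ forall i, 0 <= a i, forall i, 0 <= b i, 0 <= g &
      (g%:E + \sum_(0 <= i <oo) (a i)%:E + \sum_(0 <= i <oo) (b i)%:E = 1)%E].

(* [Posz i.+1] is the letter i+1 and [Negz i] is the letter -(i+1). *)
Definition letter_prob a b g (z : int) : R :=
  match z with
  | Posz 0 => g
  | Posz i.+1 => a i
  | Negz i => b i
  end.

Variable n : nat.
Implicit Types (w : {ffun 'I_n -> int}) (s : 'S_n).

(* The block of the letter z consists of the values v with
   #|{letters < z}| <= v < #|{letters <= z}|. *)
Definition in_blocks w s : bool :=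
  [forall k : 'I_n, (#|[set j | (w j < w k)%R]| <= s k
                                < #|[set j | (w j <= w k)%R]|)%N].

Definition ordered_in_blocks w s : bool :=
  [forall i : 'I_n, forall j : 'I_n, ((i < j)%N && (w i == w j)) ==>
     [&& (w i < 0) ==> (s j < s i)%N & (0 < w i) ==> (s i < s j)%N]].

(* Conditional probability of s given the word w: the only freedom left is the
   order in which the block of the letter 0 is written, and the m! orders of a
   block of size m are equally likely. *)
Definition shuffle_given w s : R :=
  if in_blocks w s && ordered_in_blocks w s
  then ((#|[set k | w k == 0]|)`!%:R)^-1 else 0.

Definition shuffle_pmf a b g s : \bar R :=
  \esum_(w in [set: {ffun 'I_n -> int}])
    ((\prod_(k < n) letter_prob a b g (w k)) * shuffle_given w s)%:E.

Definition is_shuffle d (T : measurableType d) (P : probability T R)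
    a b g (pi : T -> 'S_n) : Prop :=
  forall s, measurable (pi @^-1` [set s]) /\
            P (pi @^-1` [set s]) = shuffle_pmf a b g s.

End Shuffle.

Section ExtendedSchur.
Variable R : realType.
Implicit Types (a b : nat -> R) (g : R).

(* A sequence u : nat -> R stands for the formal power series \sum_k u k z^k. *)
Definition ps_one : nat -> R := fun k => (k == 0)%:R.

Definition ps_mul (u v : nat -> R) : nat -> R :=
  fun k => \sum_(i < k.+1) u i * v (k - i)%N.

(* 1 + c z *)
Definition ps_lin (c : R) : nat -> R :=
  fun k => if k is 0 then 1 else if k is 1 then c else 0.

(* [geometric 1 c] is the series 1 / (1 - c z). *)
Lemma ps_lin_geometric (c : R) : ps_mul (ps_lin (- c)) (geometric 1 c) = ps_one.
Proof.
apply/funext => -[|k]; rewrite /ps_mul /ps_one /=.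
  by rewrite big_ord1 /= !mul1r expr0.
rewrite big_ord_recl big_ord_recl /= big1 ?addr0; last by move=> i _; rewrite mul0r.
by rewrite subn0 /bump /= subn1 /= !mul1r exprS mulNr subrr.
Qed.

(* [exp_coeff g] is the series e^(g z). *)
Definition ext_gen_partial a b g (N : nat) : nat -> R :=
  ps_mul (exp_coeff g)
    (\big[ps_mul/ps_one]_(i < N) ps_mul (ps_lin (b i)) (geometric 1 (a i))).

(* The infinite product of formal power series is the coefficientwise limit of
   its partial products. *)
Definition ext_h a b g (k : nat) : R :=
  limn (fun N => ext_gen_partial a b g N k).

Definition ext_hz a b g (z : int) : R :=
  if z is Posz k then ext_h a b g k else 0.

Definition ext_schur a b g (la : seq nat) : R :=
  \det (\matrix_(i < size la, j < size la)
          ext_hz a b g ((nth 0 la i)%:Z - i%:Z + j%:Z)).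

End ExtendedSchur.

Section Tableaux.
Local Open Scope nat_scope.

Definition is_partition (n : nat) (la : seq nat) : bool :=
  [&& sorted geq la, 0 \notin la & sumn la == n].

(* A tableau is the sequence of its rows, from top to bottom. *)
Definition is_SYT (la : seq nat) (Q : seq (seq nat)) : bool :=
  [&& shape Q == la,
      perm_eq (flatten Q) (iota 1 (sumn la)),
      all (sorted ltn) Q
    & sorted (fun r1 r2 : seq nat =>
        all (fun j => nth 0 r1 j < nth 0 r2 j) (iota 0 (size r2))) Q].

(* Row insertion of x: in the current row x replaces the leftmost entry larger
   than x, which is inserted into the next row, or is appended when there is no
   such entry. The result comes with the index of the row that grew. *)
Fixpoint row_insert (x : nat) (t : seq (seq nat)) : seq (seq nat) * nat :=
  if t is r :: t' then
    let k := find (fun y => x < y) r in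
    if k < size r then
      let: (u, i) := row_insert (nth 0 r k) t' in (set_nth 0 r k x :: u, i.+1)
    else (rcons r x :: t', 0)
  else ([:: [:: x]], 0).

Definition rsk_step (PQ : seq (seq nat) * seq (seq nat)) (kx : nat * nat) :=
  let: (u, i) := row_insert kx.2 PQ.1 in
  (u, set_nth [::] PQ.2 i (rcons (nth [::] PQ.2 i) kx.1)).

(* The pair (insertion tableau, recording tableau) of the word v. *)
Definition rsk (v : seq nat) : seq (seq nat) * seq (seq nat) :=
  foldl rsk_step ([::], [::]) (zip (iota 1 (size v)) v).

Definition recording_tableau (n : nat) (s : 'S_n) : seq (seq nat) :=
  (rsk [seq val (s k) | k <- enum 'I_n]).2.

End Tableaux.

(* Main.v *)
(* Robinson-Schensted reduces the theorem to a sum over tableaux, and that sum is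
   computed by adding the letters of the alphabet one at a time.

   For a fixed recording tableau Q of shape la, sending a permutation s to its
   insertion tableau P is a bijection onto the standard tableaux of shape la,
   and v + 1 precedes v in s if and only if v + 1 lies strictly below v in P.
   The probability of s depends only on these descents: summing over the words
   rearranged as w o s^-1, which are weakly increasing with a monotonicity
   constraint on each run of equal letters, it is a fundamental quasisymmetric
   function.  So the probability of Q is the sum of these functions over all
   standard tableaux of shape la.

   For a finite alphabet this sum is det (h_(la_i - i + j)) by induction on the
   number of letters.  The entries carrying the largest letter form a vertical
   strip for a negative letter and a horizontal strip for a positive one; on the
   determinant side one multiplies the series h by 1 + b z or 1 / (1 - a z) in
   one row after the other, each step being multilinearity in that row, and the
   terms whose index is not a partition vanish because two rows coincide.  For
   the letter 0 both sides are polynomials in g, and differentiating with respect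
   to g removes a box.  Finally the alphabet {-N, ..., N} grows to all
   integers: the quasisymmetric functions increase to the probabilities, and the
   coefficients of the partial products increase to those of the infinite one. *)

Require Import Defs.
From HB Require Import structures.
From mathcomp Require Import all_boot all_order all_algebra all_fingroup.
From mathcomp Require Import all_classical all_reals all_analysis.
From mathcomp Require Import zify.

Set Implicit Arguments.
Unset Strict Implicit.
Unset Printing Implicit Defensive.

Import Order.TTheory GRing.Theory Num.Theory.
Import numFieldNormedType.Exports.

Local Open Scope classical_set_scope.
Local Open Scope ring_scope.

(** * Jacobi-Trudi determinants and standard tableaux *)

Section PowerSeries.
Variable R : realType.
Implicit Types u v w : nat -> R.

(** A coefficient of a product involves only finitely many coefficients of the factors, so the laws
    of series are inherited from polynomials. *)
Lemma ps_mul_coef u v k n : (k <= n)%N ->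
  ps_mul u v k = ((\poly_(i < n.+1) u i) * (\poly_(i < n.+1) v i))`_k.
Proof.
move=> kn; rewrite coefM; apply: eq_bigr => i _; rewrite !coef_poly.
have := ltn_ord i; rewrite ltnS => ik.
by rewrite ltnS (leq_trans ik kn) ltnS (leq_trans (leq_subr _ _) kn).
Qed.

Lemma ps_mulC : commutative (@ps_mul R).
Proof. by move=> u v; apply/funext => k; rewrite !(ps_mul_coef _ _ (leqnn k)) mulrC. Qed.

Lemma ps_mulA : associative (@ps_mul R).
Proof.
move=> u v w; apply/funext => k.
pose pol t := \poly_(i < k.+1) (t i : R).
transitivity ((pol u * (pol v * pol w))`_k).
  rewrite coefM; apply: eq_bigr => i _; rewrite coef_poly ltn_ord.
  by rewrite (ps_mul_coef _ _ (leq_subr i k)).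
rewrite mulrA coefM; apply: eq_bigr => i _.
rewrite coef_poly ltnS leq_subr (@ps_mul_coef _ _ _ k) //.
by rewrite -ltnS.
Qed.

Lemma ps_mul1u : left_id (@ps_one R) (@ps_mul R).
Proof.
move=> u; apply/funext => k.
rewrite /ps_mul /ps_one big_ord_recl /= mul1r subn0.
by rewrite big1 ?addr0 // => i _; rewrite mul0r.
Qed.

HB.instance Definition _ :=
  Monoid.isComLaw.Build (nat -> R) (@ps_one R) (@ps_mul R)
    ps_mulA ps_mulC ps_mul1u.

Lemma ps_mul_cons u v k :
  ps_mul u v k.+1 = u 0%N * v k.+1 + ps_mul (fun i => u i.+1) v k.
Proof. by rewrite /ps_mul big_ord_recl subn0. Qed.

Lemma geometricS (a : R) i : geometric 1 a i.+1 = a * geometric 1 a i.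
Proof. by rewrite /= !mul1r exprS. Qed.

Lemma ps_mul_scaled a u v k : ps_mul (fun i => a * u i) v k = a * ps_mul u v k.
Proof. by rewrite /ps_mul mulr_sumr; apply: eq_bigr => i _; rewrite mulrA. Qed.

End PowerSeries.

Section Coefficients.
Variable R : realType.
Implicit Types (h : nat -> R) (a b : R).

(** Extending by zero to negative indices lets the two recurrences that follow hold for every
    integer index. *)
Definition coefz h (z : int) : R := if z is Posz k then h k else 0.

Lemma coefz_lin b h z :
  coefz (ps_mul (ps_lin b) h) z = coefz h z + b * coefz h (z - 1).
Proof.
case: z => [[|k]|k]; last by rewrite /= mulr0 addr0.
  by rewrite /= /ps_mul big_ord1 /= mul1r mulr0 addr0.
have -> : Posz k.+1 - 1 = Posz k by lia.
rewrite /= ps_mul_cons /= mul1r; congr (_ + _).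
rewrite /ps_mul big_ord_recl /= subn0 big1 ?addr0 // => i _.
by rewrite mul0r.
Qed.

(** With [f = h / (1 - a z)] this reads [f = h + a z f]: the new series itself recurs on the right,
    unlike for the factor [1 + b z]. *)
Lemma coefz_geometric a h z :
  coefz (ps_mul (geometric 1 a) h) z =
  coefz h z + a * coefz (ps_mul (geometric 1 a) h) (z - 1).
Proof.
case: z => [[|k]|k]; last by rewrite /= mulr0 addr0.
  by rewrite /= /ps_mul big_ord1 /= !mul1r mulr0 addr0.
have -> : Posz k.+1 - 1 = Posz k by lia.
rewrite /coefz ps_mul_cons; congr (_ + _); first by rewrite /= !mul1r.
by rewrite -ps_mul_scaled; apply: eq_bigr => i _; rewrite geometricS.
Qed.

(* The coefficient z of e^(x t) h(t), as a polynomial in x. *)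
Definition exp_poly h (z : int) : {poly R} :=
  if z is Posz k then \poly_(i < k.+1) (h (k - i)%N / i`!%:R) else 0.

Lemma horner_exp_poly h z x :
  (exp_poly h z).[x] = coefz (ps_mul (exp_coeff x) h) z.
Proof.
case: z => [k|k] /=; last by rewrite horner0.
rewrite horner_poly /ps_mul; apply: eq_bigr => i _ /=.
by rewrite mulrAC [h _ * _]mulrC mulrAC.
Qed.

(** Differentiating [e^(x t) h(t)] in [x] multiplies it by [t], which shifts the coefficients by
    one. *)
Lemma deriv_exp_poly h z : (exp_poly h z)^`() = exp_poly h (z - 1).
Proof.
case: z => [[|k]|k]; last by rewrite /= deriv0.
  by apply/polyP => i; rewrite /= coef_deriv coef0 coef_poly mul0rn.
have -> : Posz k.+1 - 1 = Posz k by lia.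
apply/polyP => i; rewrite coef_deriv !coef_poly ltnS.
case: ifP => _; last by rewrite mul0rn.
rewrite subSS factS natrM invfM -(mulr_natr (_ * _)) -mulrA; congr (_ * _).
by rewrite mulrAC mulVf ?mul1r // pnatr_eq0.
Qed.

End Coefficients.

(** * Differentiation of determinants row by row *)

Section DeterminantDerivative.
Variable R : comNzRingType.

Lemma deriv_prod (I : finType) (F : I -> {poly R}) :
  (\prod_i F i)^`() = \sum_i \prod_j (if j == i then (F j)^`() else F j).
Proof.
have prodE (r : seq I) i : uniq r -> i \notin r ->
    \prod_(j <- r) (if j == i then (F j)^`() else F j) = \prod_(j <- r) F j.
  move=> _ ir; apply: eq_big_seq => j jr.
  by case: eqP => // ji; rewrite -ji jr in ir.
suff main (r : seq I) : uniq r -> (\prod_(i <- r) F i)^`() =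
    \sum_(i <- r) \prod_(j <- r) (if j == i then (F j)^`() else F j).
  by apply: main; exact: index_enum_uniq.
elim: r => [|i r IH] /=; first by rewrite !big_nil derivC.
move=> /andP[ir ur]; rewrite !big_cons derivM IH // eqxx prodE //.
congr (_ + _); rewrite mulr_sumr; apply: eq_big_seq => k kr.
rewrite big_cons; case: eqP => // ik; by rewrite ik kr in ir.
Qed.

(** Leibniz's rule applies to each product of the expansion; its factors are indexed by rows, so
    summing over the permutations gives one determinant for each differentiated row. *)
Lemma deriv_det n (M : 'M[{poly R}]_n) :
  (\det M)^`() = \sum_i \det (\matrix_(k, j) (if k == i then (M k j)^`() else M k j)).
Proof.
rewrite /determinant raddf_sum /= exchange_big /=; apply: eq_bigr => s _.
have -> : ((-1) ^+ s : {poly R}) = ((-1) ^+ s)%:P by rewrite rmorphXn /= rmorphN1.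
rewrite mul_polyC linearZ /= deriv_prod -mul_polyC mulr_sumr.
apply: eq_bigr => i _; congr (_ * _).
by apply: eq_bigr => j _; rewrite mxE.
Qed.

End DeterminantDerivative.

(** * Standard tableaux as chains of shapes *)

Section LatticePaths.
Local Open Scope nat_scope.
Implicit Types (l : nat -> nat) (m n i j : nat) (y : seq nat).

(** A partition is a function on all row indices, zero from row [m] on, so that comparing a row with
    the next one needs no special case at the end. *)
Definition is_shape m n l :=
  [/\ forall i, l i.+1 <= l i, forall i, m <= i -> l i = 0
    & \sum_(i < m) l i = n].

Definition removable l i := l i.+1 < l i.

Definition decr l j := fun i => l i - (i == j).

(* The standard tableaux of shape [l], each encoded by the rows of its entries
   listed from the largest entry to the smallest one. *)
Fixpoint paths m n l : seq (seq nat) :=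
  if n is n'.+1 then
    flatten [seq [seq i :: y | y <- paths m n' (decr l i)]
            | i <- iota 0 m & removable l i]
  else [:: [::]].

Lemma in_pathsS m n l i y :
  (i :: y \in paths m n.+1 l) =
  [&& i < m, removable l i & y \in paths m n (decr l i)].
Proof.
apply/flatten_mapP/and3P => [[k]|[im ri yP]].
  rewrite mem_filter mem_iota /= add0n => /andP[rk km] /mapP[z zP [-> ->]].
  by split.
exists i; first by rewrite mem_filter ri mem_iota.
by apply/mapP; exists y.
Qed.

Lemma size_paths m n l y : y \in paths m n l -> size y = n.
Proof.
elim: n l y => [|n IH] l [|i y] //=; first by move/flatten_mapP => [k _ /mapP[]].
by rewrite -/(paths m n.+1 l) in_pathsS => /and3P[_ _ /IH ->].
Qed.

Lemma paths_lt m n l y : y \in paths m n l -> all (fun i => i < m) y.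
Proof.
elim: n l y => [|n IH] l [|i y] //.
by rewrite in_pathsS => /and3P[/= -> _ /IH ->].
Qed.

Lemma removable_lt m n l j : is_shape m n l -> removable l j -> j < m.
Proof.
move=> [_ l0 _]; rewrite /removable ltnNge => h.
by rewrite ltnNge; apply: contra h => mj; rewrite (l0 j mj).
Qed.

Lemma shape0 m l i : is_shape m 0 l -> l i = 0.
Proof.
move=> [_ l0 ls]; case: (leqP m i) => [/l0 //|im].
by move/eqP: ls; rewrite sum_nat_eq0 => /forallP /(_ (Ordinal im)) /eqP.
Qed.

Lemma shape_gt0 m n l j : is_shape m n l -> removable l j -> 0 < n.
Proof. by case: n => // sh; rewrite /removable !(shape0 _ sh). Qed.

(** Removability is the strict inequality [l j.+1 < l j], which leaves room for row [j] to lose a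
    box. *)
Lemma decr_shape m n l j :
  is_shape m n l -> removable l j -> is_shape m n.-1 (decr l j).
Proof.
move=> sh rj; have jm := removable_lt sh rj; case: (sh) => ldec l0 ls.
split=> [i|i mi|].
- rewrite /decr; have := ldec i; move: rj; rewrite /removable.
  case: (i =P j) => [->|_]; last by case: (i.+1 =P j) => /=; lia.
  by case: (j.+1 =P j) => /=; lia.
- by rewrite /decr l0.
have lj : 0 < l j by move: rj; rewrite /removable; lia.
rewrite -ls (bigD1 (Ordinal jm)) //= [in RHS](bigD1 (Ordinal jm)) //=.
rewrite /decr eqxx (eq_bigr (fun i : 'I_m => l i)); first by move: lj; lia.
move=> i; rewrite -val_eqE /= => /negbTE ->; exact: subn0.
Qed.

Lemma paths_uniq m n l : uniq (paths m n l).
Proof.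
elim: n l => [|n IH] l //=.
have: uniq [seq i <- iota 0 m | removable l i] by rewrite filter_uniq ?iota_uniq.
elim: [seq _ <- _ | _] => [|i s IHs] //= /andP[ins us].
rewrite cat_uniq IHs // map_inj_uniq ?IH //=; last by move=> u v; case.
rewrite andbT; apply/hasPn => z /flatten_mapP[k ks /mapP[y _ ->]].
by apply: contra ins => /mapP[y' _ [<- _]].
Qed.

End LatticePaths.

Lemma big_paths (V : nmodType) (f : seq nat -> V) m n l :
  \sum_(y <- paths m n.+1 l) f y =
  \sum_(i < m | removable l i) \sum_(y <- paths m n (decr l i)) f (nat_of_ord i :: y).
Proof.
rewrite /= big_flatten big_map big_filter.
rewrite -[m in iota 0 m]subn0 -/(index_iota 0 m) big_mkord.
by apply: eq_bigr => i _; rewrite big_map.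
Qed.

(** * Row operations on Jacobi-Trudi determinants *)

Section JacobiTrudi.
Variables (K : comNzRingType) (m : nat).
Implicit Types (H : nat -> int -> K) (q : nat -> int) (l : nat -> nat).

(** Each row has its own coefficient function, so that the series can be changed one row at a time;
    [q] is integer valued because lowering a row may leave the partitions. *)
Definition jt_mx H q : 'M[K]_m :=
  \matrix_(i < m, j < m) H i (q i - i%:Z + j%:Z).

Lemma eq_jt_mx H H' q q' :
  (forall i, (i < m)%N -> H i = H' i) -> (forall i, (i < m)%N -> q i = q' i) ->
  jt_mx H q = jt_mx H' q'.
Proof. by move=> HH qq; apply/matrixP => i j; rewrite !mxE HH ?qq. Qed.

(** Multilinearity in row [j], where the shift to [z - 1] is absorbed by lowering [q j] by one. *)
Lemma det_jt_row H1 H2 H3 q c j : (j < m)%N ->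
  (forall z, H1 j z = H2 j z + c * H3 j (z - 1)) ->
  (forall i, i <> j -> H2 i = H1 i) -> (forall i, i <> j -> H3 i = H1 i) ->
  \det (jt_mx H1 q) =
  \det (jt_mx H2 q) + c * \det (jt_mx H3 (fun i => q i - (i == j)%:Z)).
Proof.
move=> jm Hj H21 H31; rewrite -[\det (jt_mx H2 q)]mul1r.
apply: (determinant_multilinear (i0 := Ordinal jm)).
- apply/rowP => k; rewrite !mxE /= eqxx Hj mul1r; congr (_ + _ * H3 _ _); lia.
- apply/matrixP => i k; rewrite !mxE H21 //.
  by move=> /eqP; rewrite -[j]/(val (Ordinal jm)) val_eqE eq_sym (negbTE (neq_lift _ _)).
- apply/matrixP => i k; rewrite !mxE.
  have ij : lift (Ordinal jm) i <> j :> nat.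
    by move=> /eqP; rewrite -[j]/(val (Ordinal jm)) val_eqE eq_sym (negbTE (neq_lift _ _)).
  by rewrite H31 // (introF eqP ij) subr0.
Qed.

(** If row [j] is not removable then [l j = l j.+1], and lowering it makes rows [j] and [j.+1] of
    the matrix equal. *)
Lemma det_jt_decr H l n j : is_shape m n l -> (j < m)%N -> H j = H j.+1 ->
  (forall k, H j (Negz k) = 0) ->
  \det (jt_mx H (fun i => (l i)%:Z - (i == j)%:Z)) =
  if removable l j then \det (jt_mx H (Posz \o decr l j)) else 0.
Proof.
move=> [ldec l0 _] jm Hjj Hneg; case: ifP => rj.
  congr (\det _); apply: eq_jt_mx => // i _; rewrite /= /decr.
  by move: rj; rewrite /removable; case: eqP => [->|_] /=; lia.
have lj : l j = l j.+1 by move: rj (ldec j); rewrite /removable; lia.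
have [jm1|] := ltnP j.+1 m.
  apply: (@determinant_alternate _ _ _ (Ordinal jm) (Ordinal jm1)) => [|k].
    by rewrite -val_eqE /= neq_ltn ltnSn.
  rewrite !mxE /= eqxx (gtn_eqF (ltnSn j)) Hjj lj; congr (H _ _); lia.
(* Row [j] is the last one and is empty; its indices [-1 - j + k] are all negative because
   [k <= j]. *)
move=> mj; have lj0 : l j = 0%N by rewrite lj l0.
rewrite (expand_det_row _ (Ordinal jm)) big1 // => k _.
rewrite mxE /= eqxx lj0.
have -> : 0%:Z - 1%:Z - j%:Z + (k : nat)%:Z = Negz (j - k)%N.
  by have := ltn_ord k; lia.
by rewrite Hneg mul0r.
Qed.

End JacobiTrudi.

(** * Quasisymmetric weights and their runs *)

Section WordWeight.
Variable R : realType.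
Variable p : int -> R.
Implicit Types (zs : seq int) (ys : seq nat) (W : seq nat -> R).

(* [dsc x y] says that the index whose statistic is [x] comes just after the
   one whose statistic is [y], and that there is a descent between them. *)
Definition letter_rel (dsc : rel nat) (z : int) : rel nat := fun x y =>
  match z with
  | Posz 0 => true
  | Posz _.+1 => ~~ dsc x y
  | Negz _ => dsc x y
  end.

(** The factor [1 / r!] comes from the uniformly random order in the block of the letter 0. *)
Definition run_weight (z : int) (r : nat) : R :=
  p z ^+ r * (if z == 0 then (r`!%:R)^-1 else 1).

(* The fundamental quasisymmetric function of a descent set, in the alphabet
   [zs] listed from its largest letter: the run of each letter must be
   increasing, decreasing or arbitrary according to the sign of the letter. *)
Fixpoint word_weight dsc zs ys : R :=
  if zs is z :: zs' then
    \sum_(r < (size ys).+1)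
      if sorted (letter_rel dsc z) (take r ys)
      then run_weight z r * word_weight dsc zs' (drop r ys) else 0
  else (ys == [::])%:R.

Definition letter_series (z : int) : nat -> R :=
  match z with
  | Posz 0 => exp_coeff (p z)
  | Posz _.+1 => geometric 1 (p z)
  | Negz _ => ps_lin (p z)
  end.

Definition alphabet_h zs : nat -> R := \big[@ps_mul R/@ps_one R]_(z <- zs) letter_series z.

Lemma eq_sorted_take (e e' : rel nat) r ys ys' : size ys = size ys' ->
  (forall k, (k.+1 < size ys)%N ->
     e (nth 0%N ys k) (nth 0%N ys k.+1) = e' (nth 0%N ys' k) (nth 0%N ys' k.+1)) ->
  sorted e (take r ys) = sorted e' (take r ys').
Proof.
elim: ys ys' r => [|x ys IH] [|x' ys'] r //= [sz] h; case: r => [|r] //=.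
have := IH ys' r sz (fun k hk => h k.+1 hk).
case: ys ys' {IH} sz h => [|x1 ys] [|x1' ys'] //= [sz] h; case: r => [|r] //= ->.
by rewrite (h 0%N).
Qed.

(** The weight sees [ys] only through the descents between neighbours; this later replaces positions
    in a permutation by rows of a tableau. *)
Lemma eq_word_weight dsc dsc' zs ys ys' : size ys = size ys' ->
  (forall k, (k.+1 < size ys)%N ->
     dsc (nth 0%N ys k) (nth 0%N ys k.+1) =
     dsc' (nth 0%N ys' k) (nth 0%N ys' k.+1)) ->
  word_weight dsc zs ys = word_weight dsc' zs ys'.
Proof.
elim: zs ys ys' => [|z zs IH] ys ys' sz h /=.
  by rewrite -!size_eq0 sz.
rewrite -sz; apply: eq_bigr => r _; move: (nat_of_ord r) => {}r.
rewrite (eq_sorted_take r (e' := letter_rel dsc' z) sz).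
  case: ifP => // _; congr (_ * _); apply: IH; first by rewrite !size_drop sz.
  by move=> k; rewrite size_drop !nth_drop addnS => hk; apply: h; lia.
by move=> k hk; rewrite /letter_rel h.
Qed.

Section Runs.
Variables (c : R) (q : rel nat).
Hypothesis q_trans : transitive q.

(** The sum over the first run for a nonzero letter of probability [c]; restricting the run to rows
    in [P] makes an induction over the rows possible. *)
Definition run_sum (P : pred nat) W (y : seq nat) : R :=
  \sum_(r < (size y).+1)
    if sorted q (take r y) && all P (take r y) then c ^+ r * W (drop r y) else 0.

(** By transitivity of [q], a run starting with [i] is a shorter run whose entries all satisfy
    [q i], so the order condition moves into [P]. *)
Lemma run_sum_cons P W i y :
  run_sum P W (i :: y) =
  W (i :: y) + if P i then c * run_sum (predI P (q i)) W y else 0.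
Proof.
rewrite /run_sum big_ord_recl /= mul1r; congr (_ + _).
case: (P i); last by rewrite big1 // => r _; rewrite andbF.
rewrite mulr_sumr; apply: eq_bigr => r _.
rewrite (path_sortedE q_trans) all_predI /= [in LHS]andbC.
rewrite [all (q i) _ && _]andbC andbA [all P _ && _]andbC -andbA.
by case: ifP => _; rewrite ?mulr0 // exprS mulrA.
Qed.

Lemma eq_run_sum P P' W y : P =1 P' -> run_sum P W y = run_sum P' W y.
Proof. by move=> PP; apply: eq_bigr => r _; rewrite (eq_all PP). Qed.

End Runs.

End WordWeight.

(** * Adding one letter to the alphabet *)

Section PathSum.
Variable R : realType.
Variable m : nat.
Implicit Types (l : nat -> nat) (h : nat -> R) (W : seq nat -> R).

Definition schur_det h l : R := \det (jt_mx m (fun=> coefz h) (Posz \o l)).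

Definition path_sum W n l : R := \sum_(y <- paths m n l) W y.

(** The two weights differ only on paths whose first entry is [j], and the rest of such a path has
    the shape with the corner of row [j] removed. *)
Lemma path_sum_split (f f' k : seq nat -> R) c j n l : is_shape m n l ->
  (j < m)%N -> f' [::] = f [::] ->
  (forall i y, f' (i :: y) = f (i :: y) + if i == j then c * k y else 0) ->
  path_sum f' n l =
  path_sum f n l + c * (if removable l j then path_sum k n.-1 (decr l j) else 0).
Proof.
move=> sh jm f0 fS; rewrite /path_sum; case: n sh => [|n] sh.
  rewrite /= !big_seq1 f0 ifN ?mulr0 ?addr0 //.
  by apply/negP => /(shape_gt0 sh).
rewrite !big_paths (eq_bigr (fun i : 'I_m => \sum_(y <- paths m n (decr l i)) f (nat_of_ord i :: y) +
    if nat_of_ord i == j then c * \sum_(y <- paths m n (decr l i)) k y else 0)); last first.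
  move=> i _; rewrite (eq_bigr _ (fun y _ => fS _ y)) big_split /=; congr (_ + _).
  by case: eqP => _; [rewrite mulr_sumr | rewrite big1].
rewrite big_split /=; congr (_ + _).
rewrite big_mkcond (bigD1 (Ordinal jm)) //= eqxx [X in _ + X]big1 ?addr0.
  by case: ifP; rewrite ?mulr0.
by move=> i; rewrite -val_eqE /= => /negbTE ->; rewrite if_same.
Qed.

Lemma run_sum_nil c q (P : pred nat) W : run_sum c q P W [::] = W [::].
Proof. by rewrite /run_sum big_ord1 /= mul1r. Qed.

(** Rows are treated from the top down: at stage [j] the rows before [j] carry the new series and
    the run may use only these. Stage [j.+1] adds the runs that start in row [j]; the rest of such a
    run lies in earlier rows, so it belongs to stage [j]. *)
Lemma neg_path_sum b h W :
  (forall n l, is_shape m n l -> path_sum W n l = schur_det h l) ->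
  forall n l, is_shape m n l ->
  path_sum (run_sum b gtn (fun i => (i < m)%N) W) n l =
  schur_det (ps_mul (ps_lin b) h) l.
Proof.
move=> HW; have tr : transitive gtn by move=> x y z /= xy yz; apply: ltn_trans yz xy.
pose H j i := coefz (if (i < j)%N then ps_mul (ps_lin b) h else h).
suff main j : (j <= m)%N -> forall n l, is_shape m n l ->
    path_sum (run_sum b gtn (fun i => (i < j)%N) W) n l =
    \det (jt_mx m (H j) (Posz \o l)).
  move=> n l sh; rewrite main //; congr (\det _); apply: eq_jt_mx => // i im.
  by rewrite /H im.
elim: j => [|j IH] jm n l sh.
  rewrite -[RHS](HW n l sh); apply: eq_bigr => -[|i y] _; rewrite ?run_sum_nil //.
  by rewrite run_sum_cons // addr0.
rewrite (@path_sum_split (run_sum b gtn (fun i => (i < j)%N) W) _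
  (run_sum b gtn (fun i => (i < j)%N) W) b j) ?run_sum_nil //; last first.
  move=> i y; rewrite !run_sum_cons // ltnS leq_eqVlt -addrA; congr (_ + _).
  (* After an entry in row [k] the run stays in rows smaller than [k], so any weaker bound [k'] is
     redundant. *)
  have runE (k k' : nat) : (k < k')%N ->
      run_sum b gtn (predI (fun i => (i < k')%N) (gtn k)) W y =
      run_sum b gtn (fun i => (i < k)%N) W y.
    by move=> kk; apply: eq_run_sum => t /=; case: (ltnP t k) => tk; rewrite ?andbF ?andbT //; lia.
  case: eqP => [->|_] /=; first by rewrite ltnn add0r runE.
  by case: ifP => ij; rewrite addr0 // !runE // ltnW.
rewrite (@det_jt_row _ m _ (H j) (H j) _ b j) //; first last.
- by move=> i ij; rewrite /H ltnS [(i <= j)%N]leq_eqVlt (introF eqP ij).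
- by move=> i ij; rewrite /H ltnS [(i <= j)%N]leq_eqVlt (introF eqP ij).
- by move=> z; rewrite /H ltnn ltnSn coefz_lin.
rewrite (IH (ltnW jm) n) // (det_jt_decr sh) //; last first.
  by rewrite /H ltnn ltnNge leqnSn.
congr (_ + _ * _); case: ifP => // rj.
by rewrite (IH (ltnW jm) n.-1) //; exact: decr_shape.
Qed.

(** Rows are treated from the bottom up. A run may use the same row repeatedly, so removing a box in
    row [j] leads back to stage [j] with one box fewer; hence a strong induction on [n] around the
    induction on [m - j]. *)
Lemma pos_path_sum a h W :
  (forall n l, is_shape m n l -> path_sum W n l = schur_det h l) ->
  forall n l, is_shape m n l ->
  path_sum (run_sum a leq xpredT W) n l = schur_det (ps_mul (geometric 1 a) h) l.
Proof.
move=> HW; pose H j i := coefz (if (j <= i)%N then ps_mul (geometric 1 a) h else h).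
suff main n : forall d j, (j + d)%N = m -> forall l, is_shape m n l ->
    path_sum (run_sum a leq (leq j) W) n l = \det (jt_mx m (H j) (Posz \o l)).
  by move=> n l sh; exact: (main n m 0%N erefl l sh).
elim/ltn_ind: n => n IHn; elim=> [|d IHd] j jd l sh.
  (* At stage [m] the run is empty, because every row of a path is smaller than [m]. *)
  rewrite addn0 in jd; transitivity (path_sum W n l).
    apply: eq_big_seq => -[|i y] yP; rewrite ?run_sum_nil // run_sum_cons; last exact: leq_trans.
    by have /andP[im _] := paths_lt yP; rewrite jd leqNgt im addr0.
  rewrite HW //; congr (\det _); apply: eq_jt_mx => // i im.
  by rewrite /H jd leqNgt im.
have jm : (j < m)%N by lia.
rewrite (@path_sum_split (run_sum a leq (leq j.+1) W) _
  (run_sum a leq (leq j) W) a j) ?run_sum_nil //; last first.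
  move=> i y; rewrite !run_sum_cons; try exact: leq_trans.
  rewrite -addrA; congr (_ + _).
  have runE (k k' : nat) : (k' <= k)%N ->
      run_sum a leq (predI (leq k') (leq k)) W y = run_sum a leq (leq k) W y.
    by move=> kk; apply: eq_run_sum => t /=; case: (leqP k t) => tk; rewrite ?andbF ?andbT //; lia.
  case: eqP => [->|/eqP ij]; first by rewrite leqnn ltnn add0r runE.
  rewrite [(j <= i)%N]leq_eqVlt eq_sym (negbTE ij) /=.
  by case: ifP => ji; rewrite addr0 // !runE // ltnW.
rewrite (@det_jt_row _ m _ (H j.+1) (H j) _ a j) //; first last.
- by move=> i ij; rewrite /H [(j <= i)%N]leq_eqVlt eq_sym (introF eqP ij).
- by move=> z; rewrite /H leqnn ltnn coefz_geometric.
rewrite (IHd j.+1) ?addSnnS // (det_jt_decr sh) //; last by rewrite /H leqnn leqnSn.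
congr (_ + _ * _); case: ifP => // rj.
have n0 := shape_gt0 sh rj.
by rewrite (IHn n.-1 _ d.+1 j jd) ?prednK //; exact: decr_shape.
Qed.

(** Both sides are polynomials in [g]. A derivative of the determinant lowers one row at a time, so
    by induction its coefficient of degree [r], multiplied by [r!], sums [W] over the paths with
    their first [r] entries dropped. *)
Lemma zero_path_sum g h W :
  (forall n l, is_shape m n l -> path_sum W n l = schur_det h l) ->
  forall n l, is_shape m n l ->
  path_sum (fun y => \sum_(r < (size y).+1) g ^+ r / r`!%:R * W (drop r y)) n l =
  schur_det (ps_mul (exp_coeff g) h) l.
Proof.
move=> HW; pose M l := jt_mx m (fun=> exp_poly h) (Posz \o l).
have hornerM x l : (\det (M l)).[x] = schur_det (ps_mul (exp_coeff x) h) l.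
  rewrite -[_.[x]]/(horner_eval x _) -det_map_mx; congr (\det _).
  by apply/matrixP => i j; rewrite !mxE /= /horner_eval horner_exp_poly.
have coefM r : forall n l, is_shape m n l ->
    (\det (M l))`_r * r`!%:R =
    path_sum (fun y => if (r <= size y)%N then W (drop r y) else 0) n l.
  elim: r => [|r IH] n l sh.
    rewrite mulr1 -horner_coef0 hornerM.
    have -> : exp_coeff (0 : R) = @ps_one R.
      apply/funext => k; rewrite /exp_coeff /ps_one /= expr0n.
      by case: k => [|k]; rewrite ?mul0r // fact0 divr1.
    rewrite ps_mul1u -(HW n) //; apply: eq_bigr => y _; by rewrite drop0.
  rewrite factS natrM mulrA [_ * r.+1%:R]mulr_natr -coef_deriv deriv_det coef_sum mulr_suml.
  have rowE (j : 'I_m) :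
      \det (\matrix_(k, t) (if k == j then (M l k t)^`() else M l k t)) =
      if removable l j then \det (M (decr l j)) else 0.
    rewrite -(det_jt_decr (H := fun=> exp_poly h) sh (ltn_ord j) erefl (fun=> erefl)).
    congr (\det _); apply/matrixP => k t; rewrite !mxE -val_eqE /=.
    by case: eqP => _; rewrite ?subr0 // deriv_exp_poly; congr exp_poly; lia.
  case: n sh => [|n] sh.
    rewrite /path_sum /= big_seq1 /= big1 // => j _.
    by rewrite rowE ifN ?coef0 ?mul0r //; apply/negP => /(shape_gt0 sh).
  rewrite /path_sum big_paths [RHS]big_mkcond; apply: eq_bigr => j _.
  rewrite rowE; case: ifP => rj; last by rewrite coef0 mul0r.
  by rewrite (IH n _ (decr_shape sh rj)).
(* No path has more than [n] entries, so [coefM] also bounds the degree in [g] by [n]. *)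
move=> n l sh; rewrite -hornerM (@horner_coef_wide _ n.+1); last first.
  apply/leq_sizeP => r nr; have := coefM r n l sh.
  rewrite /path_sum big1_seq; last first.
    by move=> y /andP[_ yP]; rewrite (size_paths yP) leqNgt nr.
  by move=> /eqP; rewrite mulf_eq0 pnatr_eq0 -leqn0 leqNgt fact_gt0 orbF => /eqP.
rewrite /path_sum [LHS](eq_big_seq (fun y =>
    \sum_(r < n.+1) g ^+ r / r`!%:R * W (drop r y))); last first.
  by move=> y yP; rewrite (size_paths yP).
rewrite exchange_big /=; apply: eq_bigr => r _.
rewrite -mulr_sumr; transitivity (g ^+ r / r`!%:R * ((\det (M l))`_r * r`!%:R)).
  rewrite (coefM _ n) //; congr (_ * _); apply: eq_big_seq => y yP.
  by rewrite (size_paths yP) -ltnS ltn_ord.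
rewrite -mulrA [X in _ * (_ * X)]mulrC mulKf; first by rewrite mulrC.
by rewrite pnatr_eq0 -lt0n fact_gt0.
Qed.

(** For the empty shape the matrix is the identity; otherwise its first row only has positive
    indices, where the series 1 vanishes. *)
Lemma nil_path_sum n l : is_shape m n l ->
  path_sum (fun y => (y == [::])%:R) n l = schur_det (@ps_one R) l.
Proof.
case: n => [|n] sh.
  rewrite /path_sum /= big_seq1 eqxx /schur_det.
  rewrite (_ : jt_mx _ _ _ = 1%:M) ?det1 //; apply/matrixP => i j.
  rewrite !mxE /= (shape0 _ sh) sub0r -val_eqE /=.
  case: ltngtP => ij.
  - have -> : - (i : nat)%:Z + (j : nat)%:Z = Posz (j - i)%N by lia.
    by rewrite /= /ps_one subn_eq0 leqNgt ij.
  - by have -> : - (i : nat)%:Z + (j : nat)%:Z = Negz (i - j).-1 by lia.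
  - by rewrite ij addrC subrr /= /ps_one.
rewrite /path_sum big1_seq; last first.
  by move=> y /andP[_ /size_paths]; case: y.
case: (sh) => ldec l0 ls; have l0_gt : (0 < l 0)%N.
  have anti i : (l i <= l 0)%N by elim: i => // i; exact: leq_trans.
  rewrite lt0n; apply/eqP => l00; move: ls; rewrite big1 // => i _.
  by apply/eqP; rewrite -leqn0 -l00.
have m0 : (0 < m)%N by case: (posnP m) => // m0; move: l0_gt; rewrite l0 ?m0.
rewrite /schur_det (expand_det_row _ (Ordinal m0)) big1 // => j _.
rewrite [jt_mx _ _ _ _ _]mxE /=.
rewrite /ps_one !addn_eq0 -leqn0 leqNgt l0_gt /=.
by rewrite mul0r.
Qed.

Lemma sorted_true (T : Type) (s : seq T) : sorted (fun _ _ => true) s.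
Proof. by case: s => //= x s; elim: s x => /=. Qed.

Theorem word_weight_path_sum (p : int -> R) zs n l : is_shape m n l ->
  path_sum (word_weight p (fun x y => (y < x)%N) zs) n l =
  schur_det (alphabet_h p zs) l.
Proof.
elim: zs n l => [|z zs IH] n l sh.
  by rewrite /alphabet_h big_nil -(nil_path_sum sh).
rewrite /alphabet_h big_cons -/(alphabet_h p zs).
case: z => [[|k]|k] /=.
- rewrite -(@zero_path_sum _ _ _ IH n) //; apply: eq_bigr => y _ /=.
  by apply: eq_bigr => r _; rewrite sorted_true /run_weight eqxx.
- rewrite -(@pos_path_sum _ _ _ IH n) //; apply: eq_bigr => y _ /=.
  apply: eq_bigr => r _; rewrite /run_weight /= mulr1 all_predT andbT.
  by rewrite (@eq_sorted _ _ leq) // => x t /=; rewrite [RHS]leqNgt.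
- rewrite -(@neg_path_sum _ _ _ IH n) //; apply: eq_big_seq => y yP /=.
  apply: eq_bigr => r _; rewrite /run_weight /= mulr1.
  suff -> : all (fun i => i < m)%N (take r y) by rewrite andbT.
  by apply/allP => i /mem_take iy; exact: (allP (paths_lt yP)).
Qed.

End PathSum.

(** * The Robinson-Schensted correspondence *)

Section Tableaux.
Local Open Scope nat_scope.
Implicit Types (r s : seq nat) (t u : seq (seq nat)) (x y z v i k : nat).

Definition below r v := count (fun z => z < v) r.

(* Column strictness is expressed by counting: below every threshold a row has
   at least as many entries as the next one. *)
Fixpoint tableau t : Prop :=
  if t is r :: t' then
    [/\ r != [::], sorted ltn r, forall v, below (head [::] t') v <= below r v
      & tableau t']
  else True.

Lemma below_leq r v w : v <= w -> below r v <= below r w.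
Proof. by move=> vw; apply: sub_count => z /= zv; apply: leq_trans vw. Qed.

Lemma below_all r v : all (fun z => z < v) r -> below r v = size r.
Proof. by rewrite all_count => /eqP. Qed.

Lemma below_none r v : all (fun z => v <= z) r -> below r v = 0.
Proof.
move=> /allP h; apply/eqP; rewrite -leqn0 leqNgt -has_count; apply/hasPn => z /h.
by rewrite leqNgt.
Qed.

Lemma below_size r v : below r v <= size r.
Proof. exact: count_size. Qed.

Lemma belowS r v : uniq r -> below r v.+1 = below r v + (v \in r).
Proof.
move=> ur; rewrite -(count_uniq_mem v ur) /below; elim: r {ur} => //= a r ->.
by rewrite ltnS leq_eqVlt; case: ltngtP => _ //=; lia.
Qed.

Lemma below_cat_cons s1 x s2 v :
  below (s1 ++ x :: s2) v = below s1 v + (x < v) + below s2 v.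
Proof. by rewrite /below count_cat /= addnA. Qed.

Lemma sorted_ltn_cat_cons s1 x s2 :
  sorted ltn (s1 ++ x :: s2) =
  [&& sorted ltn s1, sorted ltn s2, all (fun z => z < x) s1 & all (fun z => x < z) s2].
Proof.
rewrite !(sorted_pairwise ltn_trans) pairwise_cat allrel_consr /=.
case h1: (all (fun z => z < x) s1) => /=; last by rewrite !andbF.
case h2: (all (fun z => x < z) s2) => /=; last by rewrite !andbF.
rewrite !andbT; apply: andb_idl => _; apply/allrelP => a b /(allP h1) ax /(allP h2) xb.
exact: ltn_trans xb.
Qed.

Lemma sorted_ltn_uniq r : sorted ltn r -> uniq r.
Proof. exact: (sorted_uniq ltn_trans ltnn). Qed.

Lemma row_insert_append x r t : all (fun z => z < x) r ->
  row_insert x (r :: t) = (rcons r x :: t, 0).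
Proof.
move=> h /=; rewrite ifN // -has_find; apply/hasPn => z /(allP h).
by rewrite -leqNgt => /ltnW.
Qed.

Lemma row_insert_bump x y s1 s2 t : all (fun z => z < x) s1 -> x < y ->
  row_insert x ((s1 ++ y :: s2) :: t) =
  ((s1 ++ x :: s2) :: (row_insert y t).1, (row_insert y t).2.+1).
Proof.
move=> h xy /=; have -> : find (fun z => x < z) (s1 ++ y :: s2) = size s1.
  rewrite find_cat ifN /= ?xy ?addn0 //; apply/hasPn => z /(allP h).
  by rewrite -leqNgt => /ltnW.
rewrite size_cat /= addnS ltnS leq_addr nth_cat ltnn subnn /=.
case: (row_insert y t) => u i /=; congr (_ :: _, _).
by elim: s1 {h} => //= a s1 ->.
Qed.

Variant row_insert_cons_spec x r t : seq (seq nat) * nat -> Prop :=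
| RowAppend of all (fun z => z < x) r :
    row_insert_cons_spec x r t (rcons r x :: t, 0)
| RowBump s1 y s2 of r = s1 ++ y :: s2 & all (fun z => z < x) s1 & x < y :
    row_insert_cons_spec x r t
      ((s1 ++ x :: s2) :: (row_insert y t).1, (row_insert y t).2.+1).

Lemma row_insert_consP x r t : x \notin r ->
  row_insert_cons_spec x r t (row_insert x (r :: t)).
Proof.
move=> xr; have [/allP h|] := boolP (all (fun z => z < x) r).
  by rewrite row_insert_append; [constructor; apply/allP | apply/allP].
move=> nall; suff [s1 [y [s2 [-> h xy]]]] : exists s1 y s2,
    [/\ r = s1 ++ y :: s2, all (fun z => z < x) s1 & x < y].
  by rewrite row_insert_bump //; apply: RowBump.
elim: r xr nall => //= a r IH; rewrite inE negb_or => /andP[xa /IH {}IH].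
case: (ltnP a x) => [ax /= /IH [s1 [y [s2 [-> h xy]]]]|ax _].
  by exists (a :: s1), y, s2; rewrite /= ax.
by exists [::], a, r; split=> //; rewrite ltn_neqAle xa.
Qed.

Lemma row_insert_size x t k :
  size (nth [::] (row_insert x t).1 k) =
  size (nth [::] t k) + (k == (row_insert x t).2).
Proof.
elim: t x k => [|r t IH] x k /=; first by case: k => //= k; rewrite nth_nil.
case: ifP => h; last by case: k => [|k] /=; rewrite ?size_rcons ?addn1 ?addn0.
case E: (row_insert _ t) => [u i]; case: k => [|k] /=.
  by rewrite size_set_nth addn0; apply/maxn_idPr.
by rewrite -[u]/((u, i).1) -E IH E.
Qed.

Local Arguments row_insert : simpl never.

Lemma perm_bump s1 x s2 y s s' : perm_eq s (y :: s') ->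
  perm_eq ((s1 ++ x :: s2) ++ s) (x :: (s1 ++ y :: s2) ++ s').
Proof.
by move=> /seq.permP P; apply/seq.permP => a; rewrite /= !count_cat /= P /=; lia.
Qed.

Lemma row_insert_perm x t : uniq (x :: flatten t) ->
  perm_eq (flatten (row_insert x t).1) (x :: flatten t).
Proof.
elim: t x => [|r t IH] x //.
rewrite /= mem_cat negb_or cat_uniq => /andP[/andP[xr xt] /and3P[ur rt ut]].
case: row_insert_consP => // [_|s1 y s2 rE h xy].
  by rewrite /= -cats1 -catA; exact: (permEl (perm_catCA r [:: x] (flatten t))).
have yt : y \notin flatten t.
  by apply: contra rt => yt; apply/hasP; exists y => //; rewrite rE mem_cat inE eqxx orbT.
by rewrite rE; exact: perm_bump (IH y (introT andP (conj yt ut))).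
Qed.

Lemma below_rcons r x v : below (rcons r x) v = below r v + (x < v).
Proof. by rewrite -cats1 below_cat_cons addn0. Qed.

(** The clauses on the top row of the result serve the induction: they are what the row above needs
    to know in order to remain column strict after bumping. *)
Lemma tableau_row_insert x t : tableau t -> uniq (x :: flatten t) ->
  let t' := (row_insert x t).1 in
  [/\ tableau t', x \in head [::] t',
      forall v, v <= x -> below (head [::] t') v = below (head [::] t) v,
      forall v, x < v -> below (head [::] t') v <=
                maxn (below (head [::] t) v) (below (head [::] t) x).+1
    & forall v, below (head [::] t) v <= below (head [::] t') v].
Proof.
elim: t x => [|r t IH] x.
  move=> _ _ /=; rewrite inE eqxx /below /=; split=> // v; last by case: (x < v).
  by rewrite leqNgt => /negbTE ->.
move=> [r0 sr rt tt].
rewrite /= mem_cat negb_or cat_uniq => /andP[/andP[xr xt] /and3P[ur nrt ut]].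
case: row_insert_consP => // [h|s1 y s2 rE h xy].
  rewrite /= mem_rcons inE eqxx; split=> //.
  - split=> //; first by case: (r).
      by rewrite -cats1 sorted_ltn_cat_cons sr h.
    by move=> v; rewrite below_rcons; apply: leq_trans (rt v) (leq_addr _ _).
  - by move=> v vx; rewrite below_rcons [x < v]ltnNge vx addn0.
  - move=> v xv; rewrite below_rcons xv addn1 leq_max ltnS (below_all h).
    by rewrite below_size orbT.
  - by move=> v; rewrite below_rcons leq_addr.
have yt : y \notin flatten t.
  by apply: contra nrt => yt; apply/hasP; exists y => //; rewrite rE mem_cat inE eqxx orbT.
have [tt' yh lo hi mono] := IH y tt (introT andP (conj yt ut)).
move: sr; rewrite rE sorted_ltn_cat_cons => /and4P[ss1 ss2 s1y s2y].
have s2x : all (fun z => x < z) s2.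
  by apply: sub_all s2y => z; apply: ltn_trans.
have bx v : v <= y -> below s2 v = 0.
  by move=> vy; apply: below_none; apply: sub_all s2y => z /ltnW; apply: leq_trans.
have b1 v : x <= v -> below s1 v = size s1.
  by move=> xv; apply: below_all; apply: sub_all h => z zx; apply: leq_trans xv.
have geq v : below (s1 ++ y :: s2) v <= below (s1 ++ x :: s2) v.
  by rewrite !below_cat_cons leq_add2r leq_add2l; case: (ltnP y v) => // yv; rewrite (ltn_trans xy).
rewrite /= mem_cat inE eqxx orbT; split=> //.
- split=> //; first by case: (s1).
    by rewrite sorted_ltn_cat_cons ss1 ss2 h.
  (* Up to the threshold [y] the counts of the next row are unchanged. Beyond it the only new bound
     is one more than its old count at [y], and it is met by the entries of [s1] together with
     [x]. *)
  move=> v; case: (leqP v y) => vy.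
    by rewrite lo //; apply: leq_trans (geq v); rewrite -rE.
  apply: leq_trans (hi v vy) _; rewrite geq_max; apply/andP; split.
    by apply: leq_trans (geq v); rewrite -rE.
  have := rt y; rewrite rE !below_cat_cons ltnn bx // !b1 ?(ltnW xy) //; last first.
    exact: ltnW (ltn_trans xy vy).
  rewrite (ltn_trans xy vy) /= !addn0 addn1 addSn ltnS => /leq_trans; apply.
  exact: leq_addr.
- move=> v vx; rewrite !below_cat_cons [x < v]ltnNge vx [y < v]ltnNge.
  by rewrite (leq_trans vx (ltnW xy)).
- move=> v xv; rewrite leq_max !below_cat_cons xv [y < x]ltnNge (ltnW xy) (bx x) ?(ltnW xy) //.
  rewrite !b1 ?(ltnW xv) //; case: (ltnP y v) => yv; first by rewrite leqnn.
  by rewrite (bx v) // !addn0 addn1 leqnn orbT.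
Qed.

(** In reverse insertion the entry [y] coming up from the next row displaces the last entry smaller
    than itself. *)
Lemma split_last_below y r : y \notin r -> has (fun z => z < y) r ->
  exists s1 x s2, [/\ r = s1 ++ x :: s2, x < y & all (fun z => y < z) s2].
Proof.
elim: r => //= a r IH; rewrite inE negb_or => /andP[ya yr].
have [/(IH yr) [s1 [x [s2 [-> xy h]]]] _|nr] := boolP (has _ r).
  by exists (a :: s1), x, s2.
rewrite orbF => ay; exists [::], a, r; split=> //; apply/allP => z zr.
rewrite ltn_neqAle; apply/andP; split; first by apply: contraNneq yr => ->.
by rewrite leqNgt; exact: (hasPn nr).
Qed.

(** Reverse insertion, started at the corner of row [i]: the rows underneath eject some [y], which
    in turn ejects [x] from the top row. *)
Lemma row_insert_surj t i : tableau t -> uniq (flatten t) ->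
  size (nth [::] t i.+1) < size (nth [::] t i) ->
  exists x u, [/\ tableau u, uniq (x :: flatten u) & row_insert x u = (t, i)].
Proof.
elim: t i => [|r t IH] i; first by rewrite !nth_nil.
move=> [r0 sr rt tt] uf; case: i => [|i] /= ri.
  case/lastP: r r0 sr rt uf ri => // r x _ sr rt uf ri; exists x.
  move: sr; rewrite -cats1 sorted_ltn_cat_cons => /and4P[sr _ rx _].
  have ufx : uniq (x :: (r ++ flatten t)).
    by move: uf; rewrite /= -cats1 -catA (perm_uniq (permEl (perm_catCA _ _ _))).
  have [r0|r0] := boolP (r == [::]).
    move: ri ufx tt; rewrite (eqP r0) /= ltnS leqn0 size_eq0.
    case: t {IH rt uf} => [_ ufx _|r' t] /=; first by exists [::].
    by move=> /eqP -> _ [].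
  exists (r :: t); split=> //; last by rewrite row_insert_append ?cats1.
  split=> // v; case: (leqP v x) => vx.
    by have := rt v; rewrite below_rcons [x < v]ltnNge vx addn0.
  rewrite [X in _ <= X]below_all; last by apply: sub_all rx => z zx; apply: ltn_trans vx.
  by apply: leq_trans (below_size _ _) _; move: ri; rewrite size_rcons ltnS -nth0.
have [ur rnt ut] := and3P (eqbLR (cat_uniq r (flatten t)) uf).
have [y [u [tu yu ins]]] := IH i tt ut ri.
have [_ yh lo hi mono] := tableau_row_insert tu yu.
have /= pf := row_insert_perm yu.
rewrite ins /= in yh lo hi mono pf.
have yr : y \notin r.
  by apply: contra rnt => yr; apply/hasP; exists y; rewrite // (perm_mem pf) mem_head.
(* Inserting [y] raised the count of the next row just after [y]; column strictness then yields an
   entry of [r] smaller than [y]. *)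
have hy : below (head [::] u) y < below (head [::] t) y.+1.
  rewrite -lo // belowS ?yh ?addn1 //.
  by case: (t) tt => //= a t' [_ /sorted_ltn_uniq].
have hr : has (fun z => z < y) r.
  rewrite has_count; have := leq_trans hy (rt y.+1).
  by rewrite belowS ?(negbTE yr) ?addn0 ?sorted_ltn_uniq // /below; lia.
have [s1 [x [s2 [rE xy s2y]]]] := split_last_below yr hr.
move: sr; rewrite rE sorted_ltn_cat_cons => /and4P[ss1 ss2 s1x s2x].
have s1y : all (fun z => z < y) s1.
  by apply: sub_all s1x => z zx; apply: ltn_trans xy.
exists x, ((s1 ++ y :: s2) :: u); split; last by rewrite row_insert_bump // ins.
  split=> //; first by case: (s1).
    by rewrite sorted_ltn_cat_cons ss1 ss2 s1y s2y.
  move=> v; have mv := leq_trans (mono v) (rt v).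
  move: mv; rewrite rE !below_cat_cons.
  case: (leqP v x) => vx; first by rewrite [y < v]ltnNge (ltnW (leq_ltn_trans vx xy)).
  (* Putting [y] back for [x] lowers the count only at thresholds [x < v <= y], where the strictness
     of [hy] compensates. *)
  case: (ltnP y v) => yv // _.
  have := leq_trans hy (rt y.+1); rewrite rE below_cat_cons ltnS (ltnW xy).
  rewrite [below s2 y.+1]below_none // addn0 addn1 ltnS => /(leq_trans (below_leq _ yv)).
  move=> /leq_trans; apply; rewrite -addnA; apply: leq_trans (leq_addr _ _).
  rewrite [X in _ <= X]below_all ?below_size //.
  by apply: sub_all s1x => z zx; apply: ltn_trans vx.
by move: uf; rewrite rE (perm_uniq (perm_bump s1 x s2 pf)).
Qed.

Lemma row_insert_inj x1 x2 t1 t2 :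
  tableau t1 -> tableau t2 -> uniq (x1 :: flatten t1) -> uniq (x2 :: flatten t2) ->
  row_insert x1 t1 = row_insert x2 t2 -> x1 = x2 /\ t1 = t2.
Proof.
elim: t1 x1 x2 t2 => [|r1 t1 IH] x1 x2 [|r2 t2].
- by move=> _ _ _ _ [->].
- move=> _ [r20 _ _ _] _; rewrite /= mem_cat negb_or => /andP[/andP[x2r _] _].
  case: row_insert_consP => // _ [] //; case: (r2) r20 => //= a s _.
  by case: s.
- move=> [r10 _ _ _] _; rewrite /= mem_cat negb_or => /andP[/andP[x1r _] _] _.
  case: row_insert_consP => // _ [] //; case: (r1) r10 => //= a s _.
  by case: s.
move=> [r10 s1 _ tt1] [r20 s2 _ tt2].
rewrite /= !mem_cat !negb_or !cat_uniq.
move=> /andP[/andP[xr1 _] /and3P[_ nrt1 ut1]] /andP[/andP[xr2 _] /and3P[_ nrt2 ut2]].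
case: row_insert_consP => // [h1|a1 y1 b1 rE1 h1 xy1].
  by case: row_insert_consP => // h2 [/rcons_inj [-> ->] ->].
case: row_insert_consP => // a2 y2 b2 rE2 h2 xy2.
have yu1 : uniq (y1 :: flatten t1).
  apply/andP; split=> //; apply: contra nrt1 => yt; apply/hasP; exists y1 => //.
  by rewrite rE1 mem_cat mem_head orbT.
have yu2 : uniq (y2 :: flatten t2).
  apply/andP; split=> //; apply: contra nrt2 => yt; apply/hasP; exists y2 => //.
  by rewrite rE2 mem_cat mem_head orbT.
move=> [E1 E2 E3].
have [y12 t12] := IH y1 y2 t2 tt1 tt2 yu1 yu2 (injective_projections _ _ E2 E3).
subst y2 t2; move: s1 s2; rewrite rE1 rE2 !sorted_ltn_cat_cons.
move=> /and4P[_ _ _ by1] /and4P[_ _ _ by2].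
(* The place of the bump can be recovered from the new row: its entries smaller than [y1] are those
   of [a] together with [x]. *)
have cnt a x b : all (fun z => z < x) a -> x < y1 -> all (fun z => y1 < z) b ->
    below (a ++ x :: b) y1 = (size a).+1.
  move=> ax xy bb; rewrite below_cat_cons xy below_all; last first.
    by apply: sub_all ax => z zx; apply: ltn_trans xy.
  rewrite below_none ?addn0 ?addn1 //.
  by apply: sub_all bb => z; apply: ltnW.
have /eqP := E1; rewrite eqseq_cat; last first.
  by apply: succn_inj; rewrite -(cnt a1 x1 b1) // E1 cnt.
by move=> /andP[/eqP -> /eqP [-> ->]].
Qed.

Definition row_of t v := find (fun r => v \in r) t.

Lemma row_of_cons r t v : row_of (r :: t) v = if v \in r then 0 else (row_of t v).+1.
Proof. by []. Qed.

(** Bumping expels from the top row only [y], the smallest entry there exceeding [x]. Pairs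
    containing [y] are settled by the last two clauses for the insertion of [y] into the next rows;
    the other pairs keep their relative order by induction. *)
Lemma row_insert_descent x t : tableau t -> uniq (x :: flatten t) ->
  let t' := (row_insert x t).1 in
  [/\ forall v, v \in flatten t -> v.+1 \in flatten t ->
        (row_of t' v < row_of t' v.+1) = (row_of t v < row_of t v.+1),
      x.+1 \in flatten t -> row_of t' x < row_of t' x.+1
    & forall v, x = v.+1 -> v \in flatten t -> row_of t' x <= row_of t' v].
Proof.
elim: t x => [|r t IH] x //.
move=> [r0 sr rt tt].
rewrite /= mem_cat negb_or cat_uniq => /andP[/andP[xr xt] /and3P[ur nrt ut]].
have inrt v : v \in r -> v \in flatten t -> False.
  by move=> vr vt; case/hasP: nrt; exists v.
case: row_insert_consP => // [h|s1 y s2 rE h xy].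
  rewrite /=; split.
  - move=> v vt wt; rewrite !mem_rcons !inE.
    have neq z : z \in r ++ flatten t -> (z == x) = false.
      by rewrite mem_cat => zt; apply/negP => /eqP zx; move: zt; rewrite zx (negbTE xr) (negbTE xt).
    by rewrite !neq.
  - move=> _; rewrite !mem_rcons mem_head inE gtn_eqF //=.
    by case: ifP => // /(allP h); rewrite ltnNge leqnSn.
  - by move=> v _ _; rewrite mem_rcons mem_head.
have yr : y \in r by rewrite rE mem_cat mem_head orbT.
have yt : y \notin flatten t by apply/negP => /(inrt _ yr).
have [IH1 IH2 IH3] := IH y tt (introT andP (conj yt ut)).
move: sr; rewrite rE sorted_ltn_cat_cons => /and4P[ss1 ss2 s1y s2y].
have y1 : y \notin s1 by apply/negP => /(allP s1y); rewrite ltnn.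
have y2 : y \notin s2 by apply/negP => /(allP s2y); rewrite ltnn.
have mem' z : (z \in s1 ++ x :: s2) = (z == x) || (z \in r) && (z != y).
  rewrite rE !mem_cat !inE; case: (z =P y) => [->|_]; rewrite ?(negbTE y1) ?(negbTE y2).
    by rewrite andbF orbF.
  by rewrite andbT; case: (z == x); case: (z \in s1).
have gap z : z \in r -> x < z -> y <= z.
  rewrite rE mem_cat inE => /or3P[/(allP h)|/eqP ->|/(allP s2y)/ltnW] //.
  by move=> zx xz; move: (ltn_trans zx xz); rewrite ltnn.
rewrite -rE /=; split.
- move=> v; rewrite ![_ \in r ++ _]mem_cat => vt wt; rewrite !mem'.
  have vx : v != x by apply: contraTneq vt => ->; rewrite negb_or xr.
  have wx : v.+1 != x by apply: contraTneq wt => ->; rewrite negb_or xr.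
  rewrite (negbTE vx) (negbTE wx) /=.
  case: (v =P y) vt vx wt => [->|vy] vt vx wt.
    rewrite yr andbF /= [y.+1 == y]gtn_eqF // andbT; case: ifP wt => //= wr wt.
  case: (v.+1 =P y) => [wy|_].
    have vr : v \notin r.
      apply/negP => vr; have := gap v vr; rewrite ltn_neqAle eq_sym vx -ltnS wy xy.
      by move=> /(_ isT); rewrite -wy ltnn.
    move: vt; rewrite wy yr (negbTE vr) ltn0 /= ltnS ltnNge => vt.
    by rewrite (IH3 v) // wy.
  rewrite !andbT; case: ifP vt => //= vr vt; case: ifP wt => //= wr wt.
  by rewrite !ltnS IH1.
- move=> _; rewrite !mem' eqxx (gtn_eqF (ltnSn x)) /=.
  case: ifP => // /andP[wr wy]; have := gap _ wr (ltnSn x).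
  by rewrite leq_eqVlt eq_sym (negbTE wy) ltnS leqNgt xy.
- by move=> v _ _; rewrite mem' eqxx.
Qed.

End Tableaux.

Local Arguments row_insert : simpl never.

(** * Insertion of whole words and its inverse *)

Section Correspondence.
Local Open Scope nat_scope.
Implicit Types (r s w : seq nat) (t u : seq (seq nat)) (x v i k o n m : nat)
  (g y : seq nat) (l : nat -> nat).

Lemma iota_rcons o n : iota o n.+1 = rcons (iota o n) (o + n).
Proof. by rewrite -addn1 iotaD cats1. Qed.

Definition grow_step (tg : seq (seq nat) * seq nat) x :=
  ((row_insert x tg.1).1, (row_insert x tg.1).2 :: tg.2).

(* The insertion tableau, with the rows that grew, from last to first. *)
Definition grow w := foldl grow_step ([::], [::]) w.

Lemma grow_rcons w x : grow (rcons w x) = grow_step (grow w) x.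
Proof. by rewrite /grow foldl_rcons. Qed.

(** Decodes a path, newest row first, into a tableau with labels from [o] on. The offset is 1 for
    recording tableaux and 0 for insertion tableaux. *)
Fixpoint build o g : seq (seq nat) :=
  if g is i :: g' then
    set_nth [::] (build o g') i (rcons (nth [::] (build o g') i) (o + size g'))
  else [::].

Lemma size_grow w : size (grow w).2 = size w.
Proof.
by elim/last_ind: w => // w x IH; rewrite grow_rcons size_rcons /= IH.
Qed.

Lemma rsk_grow w : rsk w = ((grow w).1, build 1 (grow w).2).
Proof.
elim/last_ind: w => // w x IH.
have -> : rsk (rcons w x) = rsk_step (rsk w) ((size w).+1, x).
  by rewrite /rsk size_rcons iota_rcons zip_rcons ?size_iota // foldl_rcons add1n.
rewrite grow_rcons IH /rsk_step /=; case: (row_insert x _) => u i /=.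
by rewrite add1n size_grow.
Qed.

Lemma grow_size w k : size (nth [::] (grow w).1 k) = count_mem k (grow w).2.
Proof.
elim/last_ind: w => [|w x IH]; first by rewrite nth_nil.
by rewrite grow_rcons /= row_insert_size IH addnC eq_sym.
Qed.

Lemma tableau_grow w : uniq w ->
  tableau (grow w).1 /\ perm_eq (flatten (grow w).1) w.
Proof.
elim/last_ind: w => // w x IH; rewrite rcons_uniq => /andP[xw uw].
have [tw pw] := IH uw; have ux : uniq (x :: flatten (grow w).1).
  by rewrite /= (perm_uniq pw) (perm_mem pw) xw.
rewrite grow_rcons /=; split; first by have [] := tableau_row_insert tw ux.
apply: perm_trans (row_insert_perm ux) _.
by rewrite perm_sym perm_rcons perm_cons perm_sym.
Qed.

Lemma uniq_grow w x : uniq (rcons w x) -> uniq (x :: flatten (grow w).1).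
Proof.
rewrite rcons_uniq => /andP[xw uw]; have [_ pw] := tableau_grow uw.
by rewrite /= (perm_uniq pw) (perm_mem pw) xw.
Qed.

Lemma grow_inj w1 w2 : uniq w1 -> uniq w2 -> grow w1 = grow w2 -> w1 = w2.
Proof.
elim/last_ind: w1 w2 => [|w1 x1 IH] w2; case/lastP: w2 => [|w2 x2] //.
- by move=> _ _ /(congr1 (fun tg => size tg.2)); rewrite !size_grow size_rcons.
- by move=> _ _ /(congr1 (fun tg => size tg.2)); rewrite !size_grow size_rcons.
move=> ux1 ux2; have := uniq_grow ux1; have := uniq_grow ux2.
move: ux1 ux2; rewrite !rcons_uniq => /andP[_ u1] /andP[_ u2] ux2 ux1.
rewrite !grow_rcons => -[E1 E2 E3].
have [-> E4] := row_insert_inj (tableau_grow u1).1 (tableau_grow u2).1 ux1 ux2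
  (injective_projections _ _ E1 E2).
by rewrite (IH w2) //; apply: injective_projections.
Qed.

Lemma tableau_sorted t i : tableau t -> sorted ltn (nth [::] t i).
Proof.
by elim: t i => [|r t IH] [|i] //= [_ sr _ tt] //; exact: IH.
Qed.

Lemma tableau_below t i v : tableau t ->
  below (nth [::] t i.+1) v <= below (nth [::] t i) v.
Proof.
elim: t i => [|r t IH] i; first by rewrite !nth_nil.
move=> [_ _ rt tt]; case: i => [|i] /=; last exact: IH.
by rewrite nth0.
Qed.

Lemma tableau_neq0 t i : tableau t -> i < size t -> nth [::] t i != [::].
Proof. by elim: t i => [|r t IH] [|i] //= [r0 _ _ tt] // /IH; apply. Qed.

Lemma tableauP t : (forall i, i < size t -> nth [::] t i != [::]) ->
  (forall i, sorted ltn (nth [::] t i)) ->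
  (forall i v, below (nth [::] t i.+1) v <= below (nth [::] t i) v) ->
  tableau t.
Proof.
elim: t => //= r t IH h1 h2 h3; split; first exact: (h1 0).
- exact: (h2 0).
- by move=> v; rewrite -nth0; exact: (h3 0).
by apply: IH => i; [exact: (h1 i.+1)|exact: (h2 i.+1)|exact: (h3 i.+1)].
Qed.

Lemma eq_tableau t u : tableau t -> tableau u ->
  (forall i, nth [::] t i = nth [::] u i) -> t = u.
Proof.
move=> tt tu E; have le t1 t2 : tableau t1 ->
    (forall i, nth [::] t1 i = nth [::] t2 i) -> size t1 <= size t2.
  move=> tt1 E1; rewrite leqNgt; apply/negP => lt.
  by have := tableau_neq0 tt1 lt; rewrite E1 nth_default ?eqxx.
apply: (eq_from_nth (x0 := [::])) => // .
by apply/eqP; rewrite eqn_leq !le.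
Qed.

(** The path [g] names, at each step, the corner where reverse insertion starts. *)
Lemma grow_surj m n l g t : is_shape m n l -> g \in paths m n l ->
  tableau t -> uniq (flatten t) -> (forall k, size (nth [::] t k) = l k) ->
  exists2 w, uniq w & grow w = (t, g).
Proof.
elim: n l g t => [|n IH] l g t sh.
  rewrite inE => /eqP -> tt _ szt; exists [::] => //.
  case: t tt szt => // r t [r0 _ _ _] /(_ 0) /=; rewrite (shape0 0 sh).
  by move=> /eqP; rewrite size_eq0 (negbTE r0).
case: g => [/size_paths //|i g]; rewrite in_pathsS => /and3P[im ri gP] tt ut szt.
have [|x [u [tu ux ins]]] := @row_insert_surj t i tt ut; first by rewrite !szt.
have [] := IH (decr l i) g u (decr_shape sh ri) gP tu.
- by case/andP: ux.
- by move=> k; rewrite /decr -szt -[t]/((t, i).1) -ins row_insert_size ins /= eq_sym addnK.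
move=> w uw gw; exists (rcons w x); last by rewrite grow_rcons gw /grow_step ins.
rewrite rcons_uniq uw andbT -(perm_mem (tableau_grow uw).2) gw.
by case/andP: ux.
Qed.

Lemma nth_build o g k : nth [::] (build o g) k =
  [seq v <- iota o (size g) | nth 0 (rev g) (v - o) == k].
Proof.
elim: g k => [|i g IH] k; first by rewrite nth_nil.
rewrite [size _]/= iota_rcons filter_rcons /= nth_set_nth /= !IH.
have -> : [seq v <- iota o (size g) | nth 0 (rev (i :: g)) (v - o) == k] =
          [seq v <- iota o (size g) | nth 0 (rev g) (v - o) == k].
  apply: eq_in_filter => v; rewrite mem_iota => /andP[ov vo].
  by rewrite rev_cons nth_rcons size_rev ltn_subLR // vo.
by rewrite rev_cons nth_rcons size_rev addKn ltnn eqxx [k == i]eq_sym; case: eqP => [->|].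
Qed.

Lemma flatten_set_nth a t i s :
  count a (flatten (set_nth [::] t i s)) + count a (nth [::] t i) =
  count a (flatten t) + count a s.
Proof.
elim: t i => [|r t IH] [|i] //=; rewrite ?count_cat //=.
- by rewrite !addn0.
- by elim: i => [|i] //=; rewrite cats0 addn0.
- lia.
- by rewrite -addnA IH addnA.
Qed.

Lemma perm_build o g : perm_eq (flatten (build o g)) (iota o (size g)).
Proof.
elim: g => // i g /seq.permP IH; apply/seq.permP => a.
rewrite [size _]/= iota_rcons -cats1 count_cat -IH /=.
apply: (@addIn (count a (nth [::] (build o g) i))).
rewrite flatten_set_nth -cats1 count_cat /=; lia.
Qed.

Lemma size_build o g k : size (nth [::] (build o g) k) = count_mem k g.
Proof.
elim: g => [|i g IH]; first by rewrite nth_nil.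
rewrite /= nth_set_nth /= [k == i]eq_sym; case: eqP => [->|_]; last by rewrite add0n.
by rewrite size_rcons IH.
Qed.

Lemma paths_count m n l y k : is_shape m n l -> y \in paths m n l ->
  count_mem k y = l k.
Proof.
elim: n l y => [|n IH] l y sh.
  by rewrite inE => /eqP ->; rewrite (shape0 k sh).
case: y => [/size_paths //|i y]; rewrite in_pathsS => /and3P[im ri /IH E].
rewrite /= E; last exact: decr_shape sh ri.
rewrite /decr; have [<-|ik] := eqVneq i k; last by rewrite subn0.
by rewrite subnKC //; apply: leq_ltn_trans ri.
Qed.

Lemma shape_leq m n l i j : is_shape m n l -> i <= j -> l j <= l i.
Proof.
move=> [ldec _ _] /subnK <-; elim: (j - i) => // d IH; rewrite addSn.
exact: leq_trans (ldec _) IH.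
Qed.

Lemma tableau_build o m n l y : is_shape m n l -> y \in paths m n l ->
  tableau (build o y).
Proof.
elim: n l y => [|n IH] l y sh; first by rewrite inE => /eqP ->.
move=> yP; have cy k := paths_count k sh yP.
case: y yP cy => [/size_paths //|i y]; rewrite in_pathsS => /and3P[im ri yP] cy.
have tb := IH _ _ (decr_shape sh ri) yP.
have szb k : size (nth [::] (build o y) k) = decr l i k.
  by rewrite size_build (paths_count k (decr_shape sh ri) yP).
have lt_new k : all (fun z => z < o + size y) (nth [::] (build o y) k).
  apply/allP => z; rewrite nth_build mem_filter mem_iota => /andP[_ /andP[]] //.
apply: tableauP => /= [k|k|k v].
- rewrite size_set_nth nth_set_nth /=; case: (k =P i) => [_ _|ki].
    by case: (nth _ _ i).
  rewrite leq_max => /orP[k_le_i|]; last exact: tableau_neq0.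
  have ki' : k < i by lia.
  have ik : (k == i) = false by apply/eqP; lia.
  rewrite -size_eq0 szb -lt0n /decr ik subn0.
  by apply: leq_trans (shape_leq sh (ltnW ki')); apply: leq_ltn_trans ri.
- rewrite nth_set_nth /=; case: eqP => _; last exact: tableau_sorted.
  by rewrite -cats1 sorted_ltn_cat_cons tableau_sorted // lt_new.
rewrite !nth_set_nth /=; case: (k.+1 =P i) => [ki|_]; case: (k =P i) => [ki'|_].
- lia.
(* Past the new label both rows are counted whole, and the inequality becomes [l k.+1 <= l k]. *)
- rewrite below_rcons -ki; case: ltnP => vo; last by rewrite addn0 tableau_below.
  rewrite (below_all (v := v)); last by apply: sub_all (lt_new _) => z zo; apply: ltn_trans vo.
  rewrite (below_all (v := v)); last by apply: sub_all (lt_new _) => z zo; apply: ltn_trans vo.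
  rewrite !szb /decr -ki eqxx (ltn_eqF (ltnSn k)) subn0 subnK.
    by have [] := sh.
  by move: ri; rewrite -ki; apply: leq_ltn_trans.
- by rewrite below_rcons ki' (leq_trans (tableau_below _ _ tb)) ?leq_addr.
- exact: tableau_below.
Qed.

Lemma mem_flatten_nth t v : v \in flatten t -> exists i, v \in nth [::] t i.
Proof.
by move=> /flattenP[r rt vr]; exists (index r t); rewrite nth_index.
Qed.

Lemma nth_mem_flatten t v i : v \in nth [::] t i -> v \in flatten t.
Proof.
elim: t i => [|r t IH] [|i] //=; rewrite mem_cat; first by move=> ->.
by move=> /IH ->; rewrite orbT.
Qed.

Lemma row_ofE t v i : uniq (flatten t) -> v \in nth [::] t i -> row_of t v = i.
Proof.
elim: t i => [|r t IH] i; first by rewrite nth_nil.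
rewrite row_of_cons /= cat_uniq => /and3P[_ nrt ut]; case: i => [|i] /= vi.
  by rewrite vi.
rewrite (IH i) // ifN //; apply: contra nrt => vr; apply/hasP; exists v => //.
exact: nth_mem_flatten vi.
Qed.

Definition row_word o n t := [seq row_of t v | v <- rev (iota o n)].

Lemma size_row_word o n t : size (row_word o n t) = n.
Proof. by rewrite size_map size_rev size_iota. Qed.

Lemma row_wordS o n t : row_word o n.+1 t = row_of t (o + n) :: row_word o n t.
Proof. by rewrite /row_word -addn1 iotaD rev_cat. Qed.

Lemma row_word_build o g : row_word o (size g) (build o g) = g.
Proof.
rewrite -[RHS]revK /row_word map_rev; congr rev.
apply: (eq_from_nth (x0 := 0)) => [|j]; first by rewrite size_map size_iota size_rev.
rewrite size_map size_iota => jg; rewrite (nth_map 0) ?size_iota // nth_iota //.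
apply: row_ofE; first by rewrite (perm_uniq (perm_build o g)) iota_uniq.
by rewrite nth_build mem_filter addKn eqxx mem_iota leq_addr ltn_add2l.
Qed.

Lemma build_row_word o n t : tableau t -> perm_eq (flatten t) (iota o n) ->
  (tableau (build o (row_word o n t))) -> build o (row_word o n t) = t.
Proof.
move=> tt pt tb; apply: eq_tableau => // i.
have ut : uniq (flatten t) by rewrite (perm_uniq pt) iota_uniq.
apply: (irr_sorted_eq ltn_trans ltnn); try exact: tableau_sorted.
move=> v; rewrite nth_build mem_filter size_row_word.
have nthE : v \in iota o n -> nth 0 (rev (row_word o n t)) (v - o) = row_of t v.
  rewrite mem_iota => /andP[ov vo]; rewrite /row_word -map_rev revK.
  by rewrite (nth_map 0) ?nth_iota ?size_iota ?subnKC // ltn_subLR.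
apply/andP/idP => [[/eqP + vo]|vi].
  rewrite nthE // => <-; move: vo; rewrite -(perm_mem pt) => /mem_flatten_nth [j vj].
  by rewrite (row_ofE ut vj).
have vo : v \in iota o n by rewrite -(perm_mem pt); exact: nth_mem_flatten vi.
by rewrite nthE // (row_ofE ut vi) eqxx.
Qed.

(** The entries smaller than [o + j] form a subtableau whose row lengths are the counts [below];
    column strictness, being stated by counts, says that the row of the next entry ends in a
    corner. *)
Lemma row_word_paths o n m t : tableau t -> perm_eq (flatten t) (iota o n) ->
  size t <= m -> row_word o n t \in paths m n (fun k => size (nth [::] t k)).
Proof.
move=> tt pt tm; have ut : uniq (flatten t) by rewrite (perm_uniq pt) iota_uniq.
have -> : (fun k => size (nth [::] t k)) = (fun k => below (nth [::] t k) (o + n)).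
  apply/funext => k; rewrite below_all //; apply/allP => z /nth_mem_flatten.
  by rewrite (perm_mem pt) mem_iota => /andP[].
suff main j : j <= n ->
    row_word o j t \in paths m j (fun k => below (nth [::] t k) (o + j)) by exact: main.
elim: j => // j IH jn.
have : o + j \in flatten t by rewrite (perm_mem pt) mem_iota leq_addr ltn_add2l.
move=> /mem_flatten_nth [i ji]; rewrite row_wordS (row_ofE ut ji) in_pathsS.
have belowE k : below (nth [::] t k) (o + j.+1) = below (nth [::] t k) (o + j) + (k == i).
  rewrite addnS belowS; last exact: sorted_ltn_uniq (tableau_sorted _ tt).
  congr (_ + _); case: (k =P i) => [->|ki]; first by rewrite ji.
  by apply/eqP; rewrite eqb0; apply/negP => /(row_ofE ut); rewrite (row_ofE ut ji); lia.
apply/and3P; split.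
- apply: leq_trans tm; rewrite ltnNge; apply/negP => ti.
  by move: ji; rewrite nth_default.
- by rewrite /removable !belowE eqxx (gtn_eqF (ltnSn i)) addn0 addn1 ltnS tableau_below.
- have -> : decr (fun k => below (nth [::] t k) (o + j.+1)) i =
            (fun k => below (nth [::] t k) (o + j)).
    by apply/funext => k; rewrite /decr belowE eq_sym addnK.
  exact/IH/ltnW.
Qed.

End Correspondence.

(** * Permutations with a given recording tableau *)

Section Permutations.
Implicit Types (w : seq nat) (t Q : seq (seq nat)) (la : seq nat).

Section NatScope.
Local Open Scope nat_scope.

(** The relative rows of [v] and [v.+1] are decided when the later of the two is inserted, and later
    insertions preserve them. *)
Lemma grow_descent w v : uniq w -> v \in w -> v.+1 \in w ->
  (index v.+1 w < index v w) = (row_of (grow w).1 v < row_of (grow w).1 v.+1).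
Proof.
elim/last_ind: w => // w x IH ux; have ut := uniq_grow ux.
move: ux; rewrite rcons_uniq => /andP[xw uw].
have [tw pw] := tableau_grow uw.
have [D1 D2 D3] := row_insert_descent tw ut.
rewrite grow_rcons /= !mem_rcons !inE -cats1 !index_cat /=.
have [E|vx] := eqVneq v x; have [wx|wx] := eqVneq v.+1 x.
- by move/eqP: wx; rewrite E gtn_eqF.
- rewrite E => _ /= xw'; rewrite xw' (negbTE xw) addn0 index_mem xw' D2 //.
  by rewrite (perm_mem pw).
- move=> /= vw _; rewrite vw wx (negbTE xw) addn0 -wx; symmetry.
  have vw' : v \in flatten (grow w).1 by rewrite (perm_mem pw).
  have := D3 v (esym wx) vw'; rewrite -wx leqNgt => /negbTE ->.
  by rewrite ltnNge ltnW // index_mem.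
- move=> /= vw vw'; rewrite vw vw' IH // D1 //; by rewrite (perm_mem pw).
Qed.

Lemma nth_shape Q k : size (nth [::] Q k) = nth 0 (shape Q) k.
Proof.
have [kQ|Qk] := ltnP k (size Q); first by rewrite (nth_map [::]).
by rewrite !nth_default // size_map.
Qed.

Lemma is_shape_partition n la : is_partition n la ->
  is_shape (size la) n (nth 0 la).
Proof.
move=> /and3P[sla _ /eqP nla]; split=> [i|i|].
- have [ila|ila] := ltnP i.+1 (size la); first exact: (sortedP 0 sla).
  by rewrite nth_default.
- exact: nth_default.
- by rewrite -nla sumnE (big_nth 0) big_mkord.
Qed.

(** Passes from the entrywise form of column strictness to the counting form. *)
Lemma count_lt_leq r1 r2 v : size r2 <= size r1 ->
  (forall j, j < size r2 -> nth 0 r1 j < nth 0 r2 j) -> below r2 v <= below r1 v.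
Proof.
elim: r2 r1 => // a2 r2 IH [|a1 r1] //= sz h; apply: leq_add; last first.
  by apply: IH => // j; exact: (h j.+1).
by have := h 0 isT => /= a12; case: ltnP => // a2v; rewrite (ltn_trans a12 a2v).
Qed.

Lemma SYT_tableau n la Q : is_partition n la -> is_SYT la Q ->
  [/\ tableau Q, perm_eq (flatten Q) (iota 1 n), size Q = size la
    & forall k, size (nth [::] Q k) = nth 0 la k].
Proof.
move=> pla /and4P[/eqP shQ pQ rQ cQ]; have [ldec _ _] := is_shape_partition pla.
have szQ k : size (nth [::] Q k) = nth 0 la k by rewrite nth_shape shQ.
have sz : size Q = size la by rewrite -shQ size_map.
move: pla => /and3P[_ la0 /eqP nla]; split=> //; last by rewrite -nla.
apply: tableauP => [i iQ|i|i v].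
- rewrite -size_eq0 szQ; apply: contra la0 => /eqP <-.
  by rewrite mem_nth // -sz.
- have [iQ|iQ] := ltnP i (size Q); last by rewrite nth_default.
  exact/(allP rQ)/mem_nth.
have [iQ|iQ] := ltnP i.+1 (size Q); last by rewrite [nth _ _ i.+1]nth_default.
apply: count_lt_leq; first by rewrite !szQ ldec.
move=> j jr; have /allP/(_ j) := sortedP [::] cQ i iQ.
by rewrite mem_iota; apply.
Qed.

End NatScope.

Definition perm_word n (s : 'S_n) : seq nat := [seq val (s k) | k <- enum 'I_n].

Lemma size_perm_word n (s : 'S_n) : size (perm_word s) = n.
Proof. by rewrite size_map size_enum_ord. Qed.

Lemma nth_perm_word n (s : 'S_n) (k : 'I_n) : nth 0%N (perm_word s) k = s k.
Proof. by rewrite (nth_map k) ?size_enum_ord // nth_ord_enum. Qed.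

Lemma perm_word_inj n : injective (@perm_word n).
Proof.
move=> s s' E; apply/permP => k; apply: val_inj => /=.
by rewrite -!nth_perm_word E.
Qed.

Lemma perm_word_uniq n (s : 'S_n) : uniq (perm_word s).
Proof.
by rewrite map_inj_uniq ?enum_uniq // => i j /val_inj /perm_inj.
Qed.

Lemma perm_word_iota n (s : 'S_n) : perm_eq (perm_word s) (iota 0 n).
Proof.
have sub : {subset perm_word s <= iota 0 n}.
  by move=> v /mapP[k _ ->]; rewrite mem_iota /= ltn_ord.
apply: uniq_perm; rewrite ?perm_word_uniq ?iota_uniq //.
by have [] := uniq_min_size (perm_word_uniq s) sub; rewrite // size_iota size_perm_word.
Qed.

Lemma perm_word_surj n w : perm_eq w (iota 0 n) -> exists s : 'S_n, perm_word s = w.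
Proof.
move=> pw; have sw : size w = n by rewrite (perm_size pw) size_iota.
have wn (k : 'I_n) : (nth 0%N w k < n)%N.
  have : nth 0%N w k \in iota 0 n by rewrite -(perm_mem pw) mem_nth ?sw.
  by rewrite mem_iota.
have inj : injective (fun k => Ordinal (wn k)).
  move=> i j [] /eqP; rewrite nth_uniq ?sw //; first by move/eqP/val_inj.
  by rewrite (perm_uniq pw) iota_uniq.
exists (perm inj); apply: (@eq_from_nth _ 0%N) => [|i]; rewrite size_perm_word ?sw //.
by move=> ni; rewrite (nth_perm_word _ (Ordinal ni)) permE.
Qed.

(** Fixing the recording tableau fixes the path [gQ] of growing rows, so [grow] becomes a bijection
    in its first component, the insertion tableau. *)
Lemma recording_row_words n la Q : is_partition n la -> is_SYT la Q ->
  perm_eq [seq row_word 0 n (grow (perm_word s)).1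
          | s <- enum {: 'S_n} & recording_tableau s == Q]
    (paths (size la) n (nth 0%N la)).
Proof.
move=> pla sytQ; have [tQ pQ szQ rQ] := SYT_tableau pla sytQ.
have sh := is_shape_partition pla.
have tP (s : 'S_n) := tableau_grow (perm_word_uniq s).
have recE (s : 'S_n) : recording_tableau s = build 1 (grow (perm_word s)).2.
  by rewrite /recording_tableau -/(perm_word s) rsk_grow.
have eqla : nth 0%N la = (fun k => size (nth [::] Q k)) by apply/funext => k.
pose gQ := row_word 1 n Q.
have gQP : gQ \in paths (size la) n (nth 0%N la).
  by rewrite eqla; apply: row_word_paths => //; rewrite szQ.
have bQ : build 1 gQ = Q.
  by apply: build_row_word => //; exact: tableau_build gQP.
have growE (s : 'S_n) : recording_tableau s == Q -> (grow (perm_word s)).2 = gQ.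
  rewrite recE => /eqP E; rewrite -(row_word_build 1 (grow _).2) E.
  by rewrite size_grow size_perm_word.
have szP (s : 'S_n) : recording_tableau s == Q ->
    forall k, size (nth [::] (grow (perm_word s)).1 k) = nth 0%N la k.
  by move=> /growE E k; rewrite grow_size E (paths_count k sh gQP).
have flatP (s : 'S_n) : perm_eq (flatten (grow (perm_word s)).1) (iota 0 n).
  exact: perm_trans (tP s).2 (perm_word_iota s).
have pathP (s : 'S_n) : recording_tableau s == Q ->
    row_word 0 n (grow (perm_word s)).1 \in paths (size la) n (nth 0%N la).
  move=> rs; have -> : nth 0%N la = (fun k => size (nth [::] (grow (perm_word s)).1 k)).
    by apply/funext => k; rewrite szP.
  apply: row_word_paths => //; first exact: (tP s).1.
  rewrite leqNgt; apply/negP => lt; have := tableau_neq0 (tP s).1 lt.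
  by rewrite -size_eq0 szP // nth_default ?eqxx.
have bP (s : 'S_n) : recording_tableau s == Q ->
    build 0 (row_word 0 n (grow (perm_word s)).1) = (grow (perm_word s)).1.
  move=> rs; apply: build_row_word => //; first exact: (tP s).1.
  exact: tableau_build (pathP s rs).
apply: uniq_perm; last 1 first.
- move=> y; apply/mapP/idP => [[s]|yP].
    by rewrite mem_filter => /andP[rs _] ->; exact: pathP.
  have ty := tableau_build 0 sh yP.
  have py : perm_eq (flatten (build 0 y)) (iota 0 n).
    by rewrite -(size_paths yP) perm_build.
  (* Surjectivity: reverse insertion from the tableau with path [y], at the corners dictated by
     [gQ]. *)
  have [||w uw gw] := grow_surj sh gQP ty.
  + by rewrite (perm_uniq py) iota_uniq.
  + by move=> k; rewrite size_build (paths_count k sh yP).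
  have pw : perm_eq w (iota 0 n).
    by apply: perm_trans py; rewrite perm_sym; have [_] := tableau_grow uw; rewrite gw.
  have [s sw] := perm_word_surj pw; exists s.
    by rewrite mem_filter mem_enum andbT recE sw gw bQ.
  by rewrite sw gw /= -[in RHS](size_paths yP) row_word_build.
- rewrite map_inj_in_uniq => [|s s']; first by apply: filter_uniq; exact: enum_uniq.
  rewrite !mem_filter => /andP[rs _] /andP[rs' _] E.
  apply/perm_word_inj/grow_inj; rewrite ?perm_word_uniq //.
  apply: injective_projections; last by rewrite !growE.
  by rewrite -bP // E bP.
- exact: paths_uniq.
Qed.

(** Values are taken from the largest down, because [word_weight] consumes the alphabet from its
    largest letter. *)
Definition positions n (s : 'S_n) : seq nat :=
  [seq index v (perm_word s) | v <- rev (iota 0 n)].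

Theorem recording_weight_sum (R : realType) (p : int -> R) zs n la Q :
  is_partition n la -> is_SYT la Q ->
  \sum_(s : 'S_n | recording_tableau s == Q)
     word_weight p (fun x y => (x < y)%N) zs (positions s) =
  schur_det (size la) (alphabet_h p zs) (nth 0%N la).
Proof.
move=> pla sytQ; rewrite -(word_weight_path_sum p zs (is_shape_partition pla)).
rewrite /path_sum -(perm_big _ (recording_row_words pla sytQ)) /= big_map big_filter.
rewrite big_enum_cond /=; apply: eq_bigr => s _; apply: eq_word_weight.
  by rewrite /positions size_map size_rev size_iota size_row_word.
rewrite /positions size_map size_rev size_iota => k kn.
have nth_rev_iota j : (j < n)%N -> nth 0%N (rev (iota 0 n)) j = (n - j.+1)%N.
  by move=> jn; rewrite nth_rev ?size_iota // nth_iota //; lia.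
rewrite /row_word !(nth_map 0%N) ?size_rev ?size_iota ?(ltnW kn) //.
rewrite !nth_rev_iota ?(ltnW kn) //.
(* Neighbours in the reversed list are the values [v.+1] and [v] with [v = n - k.+2]. *)
have -> : (n - k.+1 = (n - k.+2).+1)%N by lia.
have mem v : (v < n)%N -> v \in perm_word s.
  by move=> vn; rewrite (perm_mem (perm_word_iota s)) mem_iota.
by apply: grow_descent; rewrite ?perm_word_uniq ?mem //; lia.
Qed.

End Permutations.

(** * Shuffles as words *)

Section BlockWords.
Variable R : realType.
Variable p : int -> R.
Implicit Types (zs v : seq int) (ys : seq nat).

(** For a decreasing alphabet these are the weakly decreasing words of length [n], generated run by
    run as in the recursion of [word_weight]. *)
Fixpoint block_words zs n : seq (seq int) :=
  if zs is z :: zs' then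
    [seq nseq r z ++ v | r <- iota 0 n.+1, v <- block_words zs' (n - r)%N]
  else if n is 0 then [:: [::]] else [::].

Definition sorted_word_weight v : R :=
  (\prod_(z <- v) p z) * ((count_mem 0 v)`!%:R)^-1.

(** Sortedness for this relation merges both conditions of a shuffle: the letters decrease weakly
    along decreasing values, and the positions inside a run obey the rule of its letter. *)
Definition word_step (dsc : rel nat) : rel (int * nat) := fun c c' =>
  (c'.1 < c.1) || (c.1 == c'.1) && letter_rel dsc c.1 c.2 c'.2.

Lemma block_wordsP zs n v : pairwise (fun z z' : int => z' < z) zs ->
  reflect [/\ size v = n, {subset v <= zs} & sorted (fun z z' : int => z' <= z) v]
    (v \in block_words zs n).
Proof.
elim: zs n v => [|z zs IH] n v.
  move=> _; case: n => [|n]; apply: (iffP idP) => //.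
  - by rewrite inE => /eqP ->.
  - by case; case: v.
  - by case: v => [|x v] [] // _ /(_ x (mem_head _ _)).
rewrite [pairwise _ _]/= => /andP[zmax pzs].
have tr : transitive (fun z z' : int => z' <= z) by move=> a b c ab /le_trans; apply.
apply: (iffP allpairsPdep) => [[r [u [rn /(IH _ _ pzs)[su subu sou] ->]]]|[sv subv sov]].
  rewrite mem_iota /= add0n ltnS in rn; split.
  - by rewrite size_cat size_nseq su subnKC.
  - move=> x; rewrite mem_cat inE mem_nseq => /orP[/andP[_ ->] //|/subu ->].
    by rewrite orbT.
  elim: r {rn su} => //= r; rewrite path_sortedE // => ->; rewrite andbT.
  apply/allP => x; rewrite mem_cat mem_nseq => /orP[/andP[_ /eqP ->] //|/subu].
  by move=> /(allP zmax)/ltW.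
exists (count_mem z v), (drop (count_mem z v) v).
have take_z : nseq (count_mem z v) z ++ drop (count_mem z v) v = v /\
    z \notin drop (count_mem z v) v.
  elim: v {sv} subv sov => //= x v IHv subv; rewrite path_sortedE // => /andP[xv sov].
  have [->|xz] := eqVneq x z.
    by rewrite add1n /=; have [|E nin] := IHv _ sov; [move=> y yv; apply: subv; rewrite inE yv orbT|rewrite E].
  have zv : z \notin x :: v.
    have xz' : x < z.
      have := subv x (mem_head _ _); rewrite inE (negbTE xz) => xzs.
      exact: (allP zmax).
    rewrite inE eq_sym (negbTE xz) /=; apply/negP => /(allP xv); by rewrite leNgt xz'.
  by rewrite add0n (count_memPn _) //; move: zv; rewrite inE negb_or => /andP[].
have [tz nz] := take_z; split; last by [].
  by rewrite mem_iota /= add0n ltnS -sv count_size.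
apply/IH => //; split.
- by rewrite size_drop sv.
- move=> x xv; have := subv x (mem_drop xv); rewrite inE => /orP[/eqP xz|//].
  by case/negP: nz; rewrite -{1}xz.
- by apply: drop_sorted.
Qed.

(** The length of the leading run is the multiplicity of the largest letter, so a word determines
    its decomposition. *)
Lemma block_words_uniq zs n : pairwise (fun z z' : int => z' < z) zs ->
  uniq (block_words zs n).
Proof.
elim: zs n => [|z zs IH] n; first by case: n.
rewrite [pairwise _ _]/= => /andP[zmax pzs].
have zcount r n' v : v \in block_words zs n' -> count_mem z (nseq r z ++ v) = r.
  move=> /(block_wordsP _ _ pzs)[_ sub _]; rewrite count_cat count_nseq /= eqxx mul1n.
  by rewrite (count_memPn _) ?addn0 //; apply/negP => /sub /(allP zmax); rewrite ltxx.
apply: allpairs_uniq_dep => [|r _|]; [exact: iota_uniq|exact: IH|].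
move=> c c' /allpairsPdep[r1 [v1 [_ v1P ->]]] /allpairsPdep[r2 [v2 [_ v2P ->]]] /= E.
have r12 : r1 = r2 by rewrite -(zcount r1 _ v1 v1P) E (zcount r2 _ v2 v2P).
by subst r2; move/eqP: E; rewrite eqseq_cat // eqxx => /eqP ->.
Qed.

(** At the end of the run the letter drops strictly, so nothing is required of the positions
    there. *)
Lemma sorted_zip_nseq dsc z r v ys : all (fun z' => z' < z) v -> (r <= size ys)%N ->
  sorted (word_step dsc) (zip (nseq r z ++ v) ys) =
  sorted (letter_rel dsc z) (take r ys) && sorted (word_step dsc) (zip v (drop r ys)).
Proof.
move=> vz; elim: r ys => [|r IH] [|y ys] //= rys.
have {IH} := IH ys rys; case: r rys => [|r] rys.
  rewrite drop0 take0 /= => _; case: v ys vz {rys} => [|c v] [|y' ys] //= /andP[cz _].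
  by rewrite /word_step /= cz.
case: ys rys => [|y' ys] //= rys ->; rewrite /word_step /= ltxx eqxx /=.
by rewrite andbA.
Qed.

Lemma sorted_word_weight_nseq z r v : z \notin v ->
  sorted_word_weight (nseq r z ++ v) = run_weight p z r * sorted_word_weight v.
Proof.
move=> zv; rewrite /sorted_word_weight /run_weight big_cat /= big_nseq.
rewrite count_cat count_nseq /= [z == 0]eq_sym.
have -> : iter r ( *%R (p z)) 1 = p z ^+ r by elim: r => //= r ->; rewrite exprS.
(* If [z] is 0, all zeros lie in this run and [v] contributes only [0!]; otherwise all zeros lie in
   [v]. *)
have [z0|_] := eqVneq 0 z; last by rewrite mul0n add0n mulr1 mulrA.
rewrite -z0 in zv; rewrite (count_memPn zv) mul1n addn0 fact0 invr1 mulr1.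
by rewrite mulrAC.
Qed.

Lemma block_words_weight dsc zs ys : pairwise (fun z z' : int => z' < z) zs ->
  \sum_(v <- block_words zs (size ys) | sorted (word_step dsc) (zip v ys))
    sorted_word_weight v = word_weight p dsc zs ys.
Proof.
elim: zs ys => [|z zs IH] ys.
  case: ys => [|y ys] _ /=; last by rewrite big_nil.
  by rewrite big_cons big_nil /= addr0 /sorted_word_weight big_nil /= mul1r invr1.
move=> pz; have /andP[zmax pzs] : all (fun z' => z' < z) zs && pairwise (fun z z' : int => z' < z) zs := pz.
rewrite big_mkcond -[block_words _ _]/[seq nseq r z ++ v
  | r <- index_iota 0 (size ys).+1, v <- block_words zs (size ys - r)%N].
rewrite big_allpairs_dep big_mkord [word_weight _ _ _ _]/=.
apply: eq_bigr => r _; have rys : (r <= size ys)%N by rewrite -ltnS.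
rewrite -big_mkcond -IH // size_drop big_seq_cond.
have -> : forall b (x : R), (if b then run_weight p z r * x else 0) = run_weight p z r * (if b then x else 0).
  by case=> x //; rewrite mulr0.
rewrite [RHS]fun_if; case: ifP => sr; last first.
  rewrite mulr0 big1 // => v /andP[vP]; rewrite sorted_zip_nseq ?sr //.
  by have [_ sub _] := block_wordsP _ _ pzs vP; apply/allP => x /sub/(allP zmax).
rewrite mulr_sumr [RHS]big_seq_cond; apply: eq_big => [v|v /andP[vP _]].
  case vP: (v \in _) => //=; rewrite sorted_zip_nseq ?sr //.
  by have [_ sub _] := block_wordsP _ _ pzs vP; apply/allP => x /sub/(allP zmax).
apply: sorted_word_weight_nseq; have [_ sub _] := block_wordsP _ _ pzs vP.
by apply/negP => /sub/(allP zmax); rewrite ltxx.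
Qed.

End BlockWords.

(** * Shuffles as sorted words *)

Section ShuffleWords.
Variables (R : realType) (n : nat).
Implicit Types (w : {ffun 'I_n -> int}) (s : 'S_n).

Definition word_of s w : seq int := [seq w (s^-1 k)%g | k <- rev (enum 'I_n)].

(** The value [s k] has index [n - (s k).+1] because words are read from the largest value. *)
Definition ffun_of s (v : seq int) : {ffun 'I_n -> int} :=
  [ffun k => nth 0 v (n - (s k).+1)].

Lemma size_word_of s w : size (word_of s w) = n.
Proof. by rewrite size_map size_rev size_enum_ord. Qed.

Lemma nth_rev_enum (k0 : 'I_n) i (hi : (i < n)%N) :
  nth k0 (rev (enum 'I_n)) i = rev_ord (Ordinal hi).
Proof.
apply: val_inj; rewrite nth_rev ?size_enum_ord //= nth_enum_ord //.
by rewrite -subSn // subSS leq_subr.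
Qed.

Lemma nth_word_of s w i (hi : (i < n)%N) :
  nth 0 (word_of s w) i = w (s^-1 (rev_ord (Ordinal hi)))%g.
Proof.
rewrite (nth_map (Ordinal hi)) ?size_rev ?size_enum_ord //.
by rewrite nth_rev_enum.
Qed.

Lemma word_ofK s : cancel (word_of s) (ffun_of s).
Proof.
move=> w; apply/ffunP => k; rewrite ffunE.
have hk : (n - (s k).+1 < n)%N by rewrite rev_ord_proof.
rewrite (nth_word_of _ _ hk) (_ : rev_ord _ = s k) ?permK //.
by apply: val_inj => /=; rewrite -subSn // subSS subKn // ltnW.
Qed.

Lemma ffun_ofK s v : size v = n -> word_of s (ffun_of s v) = v.
Proof.
move=> sv; apply: (@eq_from_nth _ 0); rewrite size_word_of ?sv // => i hi.
rewrite (nth_word_of _ _ hi) ffunE permKV /= -subSn // subSS subKn //.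
exact: ltnW.
Qed.

Lemma prod_word_of (p : int -> R) s w :
  \prod_(z <- word_of s w) p z = \prod_(k < n) p (w k).
Proof.
rewrite big_map (perm_big _ (permEl (perm_rev _))) /= big_enum /=.
by rewrite [RHS](reindex_inj (@perm_inj _ s^-1)%g).
Qed.

Lemma card_setP (T : finType) (P : pred T) : #|[set x | P x]%classic| = #|[pred x | P x]|.
Proof. by apply: eq_card => x; rewrite unfold_in /in_set /= asboolb. Qed.

Lemma count_word_of s w : count_mem 0 (word_of s w) = #|[set k | w k == 0]|.
Proof.
rewrite -sum1_count big_map (perm_big _ (permEl (perm_rev _))) /= big_enum_cond /=.
by rewrite card_setP -sum1_card [RHS](reindex_inj (@perm_inj _ s^-1)%g).
Qed.

Lemma position_perm s (k : 'I_n) : index (nat_of_ord k) (perm_word s) = nat_of_ord (s^-1 k)%g.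
Proof.
have := nth_perm_word s (s^-1 k)%g; rewrite permKV => <-.
by rewrite index_uniq ?perm_word_uniq ?size_perm_word.
Qed.

Lemma letter_rel_trans (z : int) : transitive (letter_rel ltn z).
Proof.
case: z => [[|k]|k] y x t //=; last exact: ltn_trans.
by rewrite -!leqNgt => yx ty; apply: leq_trans yx.
Qed.

(** Transitivity allows the condition on neighbouring values to be replaced by one on all pairs. *)
Lemma word_step_trans : transitive (word_step ltn).
Proof.
move=> [c y] [c1 x] [c2 t]; rewrite /word_step /=.
move=> /orP[h1|/andP[/eqP -> h1]] /orP[h2|/andP[/eqP <- h2]].
- by rewrite (lt_trans h2 h1).
- by rewrite h1.
- by rewrite h2.
- by rewrite eqxx (letter_rel_trans h1 h2) orbT.
Qed.

Lemma sorted_word_ofP s w :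
  reflect (forall i j : 'I_n, (s i < s j)%N ->
             (w i < w j) || (w j == w i) && letter_rel ltn (w j) j i)
    (sorted (word_step ltn) (zip (word_of s w) (positions s))).
Proof.
rewrite (sorted_pairwise word_step_trans).
have szp : size (positions s) = n by rewrite size_map size_rev size_iota.
have szz : size (zip (word_of s w) (positions s)) = n.
  by rewrite size_zip size_word_of szp minnn.
have nthE i (hi : (i < n)%N) : nth (0, 0%N) (zip (word_of s w) (positions s)) i =
    (w (s^-1 (rev_ord (Ordinal hi)))%g, nat_of_ord (s^-1 (rev_ord (Ordinal hi)))%g).
  rewrite nth_zip ?size_word_of // (nth_word_of _ _ hi); congr (_, _).
  rewrite (nth_map 0%N) ?size_rev ?size_iota // -position_perm; congr index.
  rewrite nth_rev ?size_iota // nth_iota //=; lia.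
apply: (iffP (pairwiseP (0, 0%N))) => [h i j sij|h i j].
  have hi : (n - (s i).+1 < n)%N by rewrite rev_ord_proof.
  have hj : (n - (s j).+1 < n)%N by rewrite rev_ord_proof.
  have revK' (k : 'I_n) (hk : (n - (s k).+1 < n)%N) : (s^-1)%g (rev_ord (Ordinal hk)) = k.
    rewrite (_ : rev_ord _ = s k) ?permK //.
    by apply: val_inj => /=; rewrite -subSn // subSS subKn // ltnW.
  (* The larger value [s j] is read first, hence the exchange of [i] and [j]. *)
  have := h (n - (s j).+1)%N (n - (s i).+1)%N.
  rewrite !inE szz (nthE _ hi) (nthE _ hj) !revK' /word_step /=.
  by move=> -> //; have := ltn_ord (s j); lia.
rewrite !inE szz => hi hj ij; rewrite (nthE _ hi) (nthE _ hj) /word_step /=.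
by apply: h; rewrite !permKV /=; lia.
Qed.

Lemma card_lt_perm s m : (m <= n)%N -> #|[pred j | (s j < m)%N]| = m.
Proof.
move=> mn; rewrite -sum1_card (reindex_inj (@perm_inj _ s^-1)%g) /=.
under eq_bigl => j do rewrite inE permKV.
by rewrite -(big_ord_widen n (fun=> 1%N) mn) sum1_card card_ord.
Qed.

(** The block condition says that letters increase weakly with the values written under them; the
    order condition then compares positions within equal letters. *)
Lemma blocksP s w :
  in_blocks w s && ordered_in_blocks w s =
  sorted (word_step ltn) (zip (word_of s w) (positions s)).
Proof.
have cle (i : 'I_n) : #|[pred j | (s j <= s i)%N]| = (s i).+1.
  by rewrite -[RHS](card_lt_perm s (ltn_ord (s i))).
have clt (i : 'I_n) : #|[pred j | (s j < s i)%N]| = s i.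
  by rewrite (card_lt_perm s (ltnW (ltn_ord (s i)))).
rewrite /in_blocks; under eq_forallb => k do rewrite !card_setP.
have neq (i j : 'I_n) : (i < j)%N -> (s i < s j)%N || (s j < s i)%N.
  move=> ij; rewrite -neq_ltn; apply: contraTneq ij => /val_inj/perm_inj ->.
  by rewrite ltnn.
apply/idP/sorted_word_ofP => [/andP[/forallP blk /forallP ord] i j sij|h].
  (* If [w j < w i], the block of [w j] would end before that of [w i] begins, forcing
     [s j < s i]. *)
  have wij : w i <= w j.
    rewrite leNgt; apply/negP => wji.
    have /andP[le_i _] := blk i; have /andP[_ lt_j] := blk j.
    have := leq_trans lt_j (leq_trans (subset_leq_card _) le_i).
    rewrite ltnNge (ltnW sij) => /(_ _)/notF; apply.
    by apply/fintype.subsetP => k; rewrite !inE => /le_lt_trans; apply.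
  move: wij; rewrite le_eqVlt => /orP[/eqP E|-> //]; rewrite E eqxx ltxx /=.
  have ord' (k l : 'I_n) : (k < l)%N -> w k = w l ->
      (w k < 0 -> (s l < s k)%N) /\ (0 < w k -> (s k < s l)%N).
    move=> kl wkl; have /forallP/(_ l) := ord k; rewrite kl wkl eqxx /=.
    by move=> /andP[/implyP h1 /implyP h2].
  have ij : i != j :> nat.
    by apply: contraTneq sij => /val_inj ->; rewrite ltnn.
  case wE : (w j) => [[|k]|k] //=.
    rewrite -leqNgt leqNgt; apply/negP => ji.
    by have [_] := ord' j i ji (esym E); rewrite wE => /(_ isT); lia.
  have [ij'|ji|/eqP] := ltngtP i j; last by rewrite (negbTE ij).
    by have [+ _] := ord' i j ij' E; rewrite E wE => /(_ isT); lia.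
  by [].
have mono i j : (s i < s j)%N -> w i <= w j.
  by move=> /h /orP[/ltW //|/andP[/eqP -> _]].
apply/andP; split.
  (* Strictly smaller letters carry values smaller than [s k], and values up to [s k] lie under
     letters at most [w k]; counting gives both ends of the block. *)
  apply/forallP => k; apply/andP; split.
    rewrite -(clt k); apply: subset_leq_card; apply/fintype.subsetP => j; rewrite !inE => wjk.
    rewrite ltnNge leq_eqVlt; apply/negP => /orP[/eqP/val_inj/perm_inj E|/mono].
      by move: wjk; rewrite E ltxx.
    by rewrite leNgt wjk.
  rewrite -(cle k); apply: subset_leq_card; apply/fintype.subsetP => j; rewrite !inE.
  by rewrite leq_eqVlt => /orP[/eqP/val_inj/perm_inj -> //|/mono].
apply/forallP => i; apply/forallP => j; apply/implyP => /andP[ij /eqP wij].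
apply/andP; split; apply/implyP => wi.
  have /orP[sij|//] := neq i j ij; have := h i j sij; rewrite wij ltxx eqxx /=.
  by move: wi; rewrite wij; case: (w j) => [[|k]|k] //= _; lia.
have /orP[//|sji] := neq i j ij; have := h j i sji; rewrite wij ltxx eqxx /=.
by move: wi; rewrite wij; case: (w j) => [[|k]|k] //= _; lia.
Qed.

Lemma shuffle_givenE s w (p : int -> R) :
  (\prod_(k < n) p (w k)) * shuffle_given R w s =
  if sorted (word_step ltn) (zip (word_of s w) (positions s))
  then sorted_word_weight p (word_of s w) else 0.
Proof.
rewrite /shuffle_given blocksP /sorted_word_weight prod_word_of count_word_of.
by case: ifP => _; rewrite ?mulr0.
Qed.

End ShuffleWords.

(** * Passage to infinite alphabets *)

Section FiniteAlphabets.
Implicit Types N : nat.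

Definition box N : seq int :=
  [seq Posz i.+1 | i <- rev (iota 0 N)] ++ Posz 0 :: [seq Negz i | i <- iota 0 N].

Lemma mem_box N (z : int) : (z \in box N) = (- N%:Z <= z <= N%:Z).
Proof.
rewrite mem_cat inE; case: z => [[|k]|k].
- by rewrite eqxx orbT; lia.
- rewrite mem_map ?mem_rev ?mem_iota /=; last by move=> i j [].
  have -> : (Posz k.+1 \in [seq Negz i | i <- iota 0 N]) = false by apply/mapP => -[].
  by lia.
- rewrite (mem_map (f := Negz)) ?mem_iota /=; last by move=> i j [].
  have -> : (Negz k \in [seq Posz i.+1 | i <- rev (iota 0 N)]) = false by apply/mapP => -[].
  by lia.
Qed.

Lemma box_decreasing N : pairwise (fun z z' : int => z' < z) (box N).
Proof.
rewrite pairwise_cat /= !pairwise_map; apply/and4P; split.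
- apply/allrelP => x y /mapP[i _ ->]; rewrite inE => /orP[/eqP -> //|/mapP[j _ ->]] //.
- rewrite -(@sorted_pairwise _ (fun i j : nat => Posz j.+1 < Posz i.+1)); last first.
    by move=> i j k /= ij jk; apply: lt_trans jk ij.
  by rewrite rev_sorted; apply: sub_sorted (iota_ltn_sorted 0 N) => i j /=; lia.
- by apply/allP => x /mapP[i _ ->].
- rewrite -(@sorted_pairwise _ (fun i j : nat => Negz j < Negz i)); last first.
    by move=> i j k /= ij jk; apply: lt_trans jk ij.
  by apply: sub_sorted (iota_ltn_sorted 0 N) => i j /=; lia.
Qed.

Lemma block_words_box_sub N M n : (N <= M)%N ->
  {subset block_words (box N) n <= block_words (box M) n}.
Proof.
move=> NM v /(block_wordsP _ _ (box_decreasing N))[sv sub so].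
apply/block_wordsP; first exact: box_decreasing.
by split=> // x /sub; rewrite !mem_box; lia.
Qed.

(** Commutativity of the product of series pairs the letters [i + 1] and [-(i + 1)] into one
    factor. *)
Lemma alphabet_h_box (R : realType) (a b : nat -> R) g N :
  alphabet_h (letter_prob a b g) (box N) = ext_gen_partial a b g N.
Proof.
rewrite /alphabet_h /box big_cat big_cons !big_map /= (perm_big _ (permEl (perm_rev _))) /=.
have -> : iota 0 N = index_iota 0 N by rewrite /index_iota subn0.
rewrite !big_mkord.
by rewrite /ext_gen_partial big_split /= Monoid.mulmCA [ps_mul (\big[_/_]_(i < N) _) _]Monoid.mulmC.
Qed.

End FiniteAlphabets.

(** * Monotone limits over growing alphabets *)

Section Limits.
Variable R : realType.

(** For non-negative terms the sum is the supremum of finite partial sums, and the sets [W N] need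
    only exhaust the support of [f]. *)
Lemma esum_cvg (T : choiceType) (f : T -> R) (W : nat -> seq T) :
  (forall t, 0 <= f t) -> (forall N, uniq (W N)) ->
  (forall N M, (N <= M)%N -> {subset W N <= W M}) ->
  (forall t, f t != 0 -> exists N, t \in W N) ->
  (\sum_(t <- W N) f t)%:E @[N --> \oo] --> \esum_(t in [set: T]) (f t)%:E.
Proof.
move=> f0 uW mono cov.
have le_sum (L L' : seq T) : uniq L -> uniq L' ->
    (forall t, t \in L -> f t != 0 -> t \in L') ->
    \sum_(t <- L) f t <= \sum_(t <- L') f t.
  move=> uL uL' sub.
  rewrite [X in X <= _](bigID (fun t => t \in L')) /= [X in _ + X]big1_seq ?addr0; last first.
    by move=> t /andP[tL' tL]; apply: contraNeq tL' => /(sub _ tL).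
  rewrite [X in _ <= X](bigID (fun t => t \in L)) /=.
  rewrite -[X in X <= _]big_filter -[X in _ <= X + _]big_filter.
  rewrite (perm_big [seq t <- L' | t \in L]); last first.
    by apply: uniq_perm; rewrite ?filter_uniq // => t; rewrite !mem_filter andbC.
  by rewrite lerDl sumr_ge0.
pose u N := (\sum_(t <- W N) f t)%:E.
have nd : nondecreasing_seq u.
  by move=> N M NM; rewrite lee_fin; apply: le_sum => // t /(mono _ _ NM).
have -> : \esum_(t in [set: T]) (f t)%:E = ereal_sup (range u); last first.
  exact: ereal_nondecreasing_cvgn.
apply/eqP; rewrite eq_le; apply/andP; split; apply: ge_ereal_sup => /= x.
  move=> [A [finA _] <-].
  have exN (L : seq T) : exists N, forall t, t \in L -> f t != 0 -> t \in W N.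
    elim: L => [|t L [N IH]]; first by exists 0%N.
    have [ft0|ft0] := eqVneq (f t) 0.
      by exists N => t'; rewrite inE => /orP[/eqP ->|/IH //]; rewrite ft0 eqxx.
    have [M tM] := cov t ft0; exists (maxn N M) => t'; rewrite inE => /orP[/eqP -> _|/IH h /h].
      by apply: mono tM; rewrite leq_maxr.
    by apply: mono; rewrite leq_maxl.
  have [N subN] := exN (finmap.enum_fset (fset_set A)).
  apply: (@le_trans _ _ (u N)); last by apply: ereal_sup_ubound; exists N.
  by rewrite fsbig_finite //= sumEFin lee_fin; apply: le_sum => //; exact: finmap.fset_uniq.
move=> [N _ <-]; apply: esum_ge; exists [set` W N]; first by split; [exact: finite_seq|].
by rewrite -fsbig_seq // sumEFin.
Qed.

Variables (a b : nat -> R) (g : R).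
Hypotheses (a0 : forall i, 0 <= a i) (b0 : forall i, 0 <= b i) (g0 : 0 <= g).
Let p := letter_prob a b g.

Lemma letter_prob_ge0 z : 0 <= p z.
Proof. by case: z => [[|k]|k] /=. Qed.

Lemma shuffle_given_ge0 n (w : {ffun 'I_n -> int}) s : 0 <= shuffle_given R w s.
Proof. by rewrite /shuffle_given; case: ifP => // _; rewrite invr_ge0. Qed.

Lemma word_weight_cvg n (s : 'S_n) :
  (word_weight p ltn (box N) (positions s))%:E @[N --> \oo] --> shuffle_pmf a b g s.
Proof.
pose ok v := sorted (word_step ltn) (zip v (positions s)).
pose W N := [seq ffun_of s v | v <- block_words (box N) n & ok v].
pose f (w : {ffun 'I_n -> int}) := (\prod_(k < n) p (w k)) * shuffle_given R w s.
have szw N v : v \in block_words (box N) n -> size v = n.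
  by move=> /(block_wordsP _ _ (box_decreasing N))[].
have fE v : size v = n -> f (ffun_of s v) = if ok v then sorted_word_weight p v else 0.
  by move=> sv; rewrite /f shuffle_givenE ffun_ofK.
have WE N : \sum_(w <- W N) f w = word_weight p ltn (box N) (positions s).
  rewrite -block_words_weight ?box_decreasing //.
  have -> : size (positions s) = n by rewrite size_map size_rev size_iota.
  rewrite big_map big_filter big_seq_cond [RHS]big_seq_cond.
  by apply: eq_bigr => v /andP[vN okv]; rewrite fE ?okv // (szw N).
rewrite -(_ : (fun N => (\sum_(w <- W N) f w)%:E) = (fun N => _)); last first.
  by apply/funext => N; rewrite WE.
apply: esum_cvg.
- by move=> w; rewrite mulr_ge0 ?shuffle_given_ge0 ?prodr_ge0 // => k _; exact: letter_prob_ge0.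
- move=> N; rewrite map_inj_in_uniq ?filter_uniq ?block_words_uniq ?box_decreasing //.
  move=> v v'; rewrite !mem_filter => /andP[_ vN] /andP[_ v'N] E.
  by rewrite -(ffun_ofK s (szw _ _ vN)) E ffun_ofK // (szw _ _ v'N).
- move=> N M NM w /mapP[v + ->]; rewrite mem_filter => /andP[okv vN].
  by apply: map_f; rewrite mem_filter okv (block_words_box_sub NM).
move=> w; rewrite /f shuffle_givenE -/(ok _); case: ifP => [okw _|]; last by rewrite eqxx.
(* A word has finitely many letters, so their largest absolute value gives an alphabet containing
   them all. *)
have [N bN] : exists N : nat, forall k : 'I_n, w k \in box N.
  exists (\max_(k < n) `|w k|%N) => k; rewrite mem_box.
  have := @leq_bigmax _ (fun k : 'I_n => `|w k|%N) k.
  by move: (bigop.body _ _ _) => M; case: (w k) => z /=; lia.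
exists N; apply/mapP; exists (word_of s w); last by rewrite word_ofK.
rewrite mem_filter okw; apply/block_wordsP; first exact: box_decreasing.
split; first exact: size_word_of.
- by move=> z /mapP[k _ ->].
(* Forgetting the positions in [word_step] leaves weakly decreasing letters. *)
move: okw; rewrite /ok; have : size (word_of s w) = size (positions s).
  by rewrite size_word_of size_map size_rev size_iota.
case: (word_of s w) (positions s) => [|c v] [|y ys] //=.
elim: v c y ys => [|c' v IH] c y [|y' ys] //= [sz] /andP[st okv].
rewrite (IH c' y' ys) ?sz // andbT; move: st; rewrite /word_step /=.
by case/orP=> [/ltW //|/andP[/eqP -> _]].
Qed.

Lemma ps_mul_ge0 (u v : nat -> R) : (forall k, 0 <= u k) -> (forall k, 0 <= v k) ->
  forall k, 0 <= ps_mul u v k.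
Proof. by move=> u0 v0 k; apply: sumr_ge0 => i _; rewrite mulr_ge0. Qed.

(** The product is bounded by a sum of terms [x ^ i * y ^ (k - i)], and binomial coefficients are at
    least 1. *)
Lemma ps_mul_le_exp (u v : nat -> R) x y :
  (forall k, 0 <= u k <= x ^+ k) -> (forall k, 0 <= v k <= y ^+ k) ->
  forall k, 0 <= ps_mul u v k <= (x + y) ^+ k.
Proof.
move=> hu hv k; have x0 : 0 <= x by have /andP[/le_trans h1 h2] := hu 1%N; rewrite -[x]expr1; exact: h1.
have y0 : 0 <= y by have /andP[/le_trans h1 h2] := hv 1%N; rewrite -[y]expr1; exact: h1.
apply/andP; split.
  by apply: ps_mul_ge0 => i; [case/andP: (hu i)|case/andP: (hv i)].
rewrite addrC exprDn; apply: ler_sum => i _.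
have /andP[u0 ux] := hu i; have /andP[v0 vy] := hv (k - i)%N.
rewrite mulrC; apply: le_trans (ler_pM v0 u0 vy ux) _.
rewrite -[X in X <= _]mulr1n ler_wpMn2l // ?mulr_ge0 ?exprn_ge0 //.
by rewrite bin_gt0 -ltnS.
Qed.

Lemma ext_factor_le i k :
  0 <= ps_mul (ps_lin (b i)) (geometric 1 (a i)) k <= (b i + a i) ^+ k.
Proof.
apply: ps_mul_le_exp => {}k.
  by case: k => [|[|k]] /=; rewrite ?expr0 ?expr1 ?ler01 ?lexx ?b0 //= exprn_ge0.
by rewrite /= mul1r lexx exprn_ge0.
Qed.

Lemma ext_gen_partial_bound N k :
  0 <= ext_gen_partial a b g N k <= (g + \sum_(i < N) (b i + a i)) ^+ k.
Proof.
apply: ps_mul_le_exp => {}k.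
  rewrite exp_coeff_ge0 //= ler_pdivrMr ?ltr0n ?fact_gt0 //.
  by rewrite ler_peMr ?exprn_ge0 // ler1n fact_gt0.
elim: N k => [|N IH] k.
  by rewrite !big_ord0 /ps_one; case: k => [|k]; rewrite ?expr0 ?lexx ?ler01 //= exprn_ge0 ?lexx.
by rewrite !big_ord_recr /=; apply: ps_mul_le_exp => // {}k; exact: ext_factor_le.
Qed.

Lemma ext_gen_partialS N :
  ext_gen_partial a b g N.+1 =
  ps_mul (ext_gen_partial a b g N) (ps_mul (ps_lin (b N)) (geometric 1 (a N))).
Proof. by rewrite /ext_gen_partial big_ord_recr /= Monoid.mulmA. Qed.

(** Each new factor has constant term 1 and non-negative coefficients. *)
Lemma ext_gen_partial_nondecreasing k :
  nondecreasing_seq (fun N => ext_gen_partial a b g N k).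
Proof.
apply/nondecreasing_seqP => N; rewrite ext_gen_partialS [leRHS]/ps_mul big_ord_recr /= subnn.
have -> : ps_mul (ps_lin (b N)) (geometric 1 (a N)) 0%N = 1.
  by rewrite /ps_mul big_ord1 /= !mulr1.
rewrite mulr1 lerDr sumr_ge0 // => i _.
have /andP[h1 _] := ext_gen_partial_bound N i.
by have /andP[h2 _] := ext_factor_le N (k - i)%N; rewrite mulr_ge0.
Qed.

Lemma ext_h_cvg k : shuffle_params a b g ->
  ext_gen_partial a b g N k @[N --> \oo] --> ext_h a b g k.
Proof.
move=> [_ _ _ tot]; apply: nondecreasing_is_cvgn.
  exact: ext_gen_partial_nondecreasing.
(* The parameters have total mass 1, so the base of the power bounding the coefficient is at most
   1. *)
exists 1 => _ [N _ <-]; have /andP[_ /le_trans] := ext_gen_partial_bound N k; apply.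
apply: exprn_ile1; first by rewrite addr_ge0 // sumr_ge0 // => i _; rewrite addr_ge0.
have series_ge (c : nat -> R) : (forall i, 0 <= c i) ->
    ((\sum_(i < N) c i)%:E <= \sum_(0 <= i <oo) (c i)%:E)%E.
  move=> c0; rewrite -sumEFin -(big_mkord xpredT (fun i => (c i)%:E)).
  by apply: nneseries_lim_ge => i _ _; rewrite lee_fin.
rewrite big_split /= -lee_fin -tot !EFinD [X in (_ + X <= _)%E]addeC addeA.
by apply: leeD; [apply: leeD|]; rewrite ?series_ge.
Qed.

End Limits.

(** * Positivity, continuity of the determinant and the final limit *)

Lemma word_weight_ge0 (R : realType) (p : int -> R) dsc zs ys :
  (forall z, 0 <= p z) -> 0 <= word_weight p dsc zs ys.
Proof.
move=> p0; elim: zs ys => [|z zs IH] ys /=; first exact: ler0n.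
apply: sumr_ge0 => r _; case: ifP => // _; rewrite mulr_ge0 // mulr_ge0 ?exprn_ge0 //.
by case: ifP => // _; rewrite invr_ge0.
Qed.

Lemma schur_det_cvg (R : realType) m (h : nat -> nat -> R) (h' : nat -> R) l :
  (forall k, h N k @[N --> \oo] --> h' k) ->
  schur_det m (h N) l @[N --> \oo] --> schur_det m h' l.
Proof.
move=> hcvg; apply: cvg_big => [|s _]; first exact: add_continuous.
apply: cvgM; first exact: cvg_cst.
apply: cvg_big => [|i _]; first exact: mul_continuous.
rewrite mxE; under eq_cvg do rewrite mxE.
by case: (_ + _) => k /=; [exact: hcvg|exact: cvg_cst].
Qed.

Theorem theorem3 (R : realType) (a b : nat -> R) (g : R)
    (hparams : shuffle_params a b g)
    (n : nat) (hn : (0 < n)%N)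
    (d : measure_display) (T : measurableType d) (P : probability T R)
    (pi : T -> 'S_n) (hpi : is_shuffle P a b g pi)
    (la : seq nat) (hla : is_partition n la)
    (Q : seq (seq nat)) (hQ : is_SYT la Q) :
  P [set t | recording_tableau (pi t) = Q] = (ext_schur a b g la)%:E.
Proof.
have [a0 b0 g0 _] := hparams; pose p := letter_prob a b g.
pose r := [seq s <- enum {: 'S_n} | recording_tableau s == Q].
(* The event is a finite disjoint union over the permutations whose recording tableau is [Q]. *)
have -> : [set t | recording_tableau (pi t) = Q] =
    \bigcup_(s in [set` r]) pi @^-1` [set s].
  apply/seteqP; split=> [t /= tQ|t [s /=]].
    by exists (pi t) => //=; rewrite mem_filter tQ eqxx mem_enum.
  by rewrite mem_filter => /andP[/eqP <- _] ->.
rewrite measure_fin_bigcup; [|exact: finite_seq| |]; last 2 first.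
- by move=> s s' _ _ [t [/= -> ->]].
- by move=> s _; exact: (hpi s).1.
rewrite -fsbig_seq /=; last by apply: filter_uniq; exact: enum_uniq.
rewrite (eq_bigr (shuffle_pmf a b g)) => [|s _]; last exact: (hpi s).2.
rewrite big_filter big_enum_cond /=.
(* The determinants for the alphabets [box N] converge both to the probability and to the extended
   Schur function. *)
pose F N := (schur_det (size la) (ext_gen_partial a b g N) (nth 0%N la))%:E.
have lim1 : F N @[N --> \oo] -->
    (\sum_(s : 'S_n | recording_tableau s == Q) shuffle_pmf a b g s)%E.
  rewrite (_ : F = fun N => (\sum_(s : 'S_n | recording_tableau s == Q)
      (word_weight p ltn (box N) (positions s))%:E)%E); last first.
    apply/funext => N; rewrite sumEFin (recording_weight_sum p (box N) hla hQ).
    by rewrite alphabet_h_box.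
  apply: cvg_nnesum => s _; last exact: word_weight_cvg.
  by apply: nearW => N; rewrite lee_fin word_weight_ge0 //; exact: letter_prob_ge0.
have lim2 : F N @[N --> \oo] --> (ext_schur a b g la)%:E.
  apply: cvg_EFin; first by apply: nearW.
  by apply: schur_det_cvg => k; exact: ext_h_cvg.
exact: cvg_unique lim1 lim2.
Qed.
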